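(* Let $R>0$, $\gamma=0$ and $\boldsymbol y=\boldsymbol 0$. There exist constants $c,C>0$ (independent of $\boldsymbol z,\boldsymbol\alpha,\boldsymbol\beta$) such that for all $\boldsymbol z\in B_R$ and $\boldsymbol\alpha,\boldsymbol\beta\in S$, $$c\,\frac{|\boldsymbol{\alpha}\cdot\bar{\boldsymbol{\beta}}|}{\sqrt{D_0}}\le \left|K_{(\boldsymbol 0,\boldsymbol\alpha)}(\boldsymbol z,\boldsymbol\beta)\right|\le C\,\frac{|\boldsymbol{\alpha}\cdot\bar{\boldsymbol{\beta}}|}{\sqrt{D_0}},\qquad D_0=\frac{R^2}{4\pi\left(R^2-|\boldsymbol{z}|^2\right)^2},$$ where $K_{(\boldsymbol 0,\boldsymbol\alpha)}$ is the point spread function with parameter $\gamma=0$.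
   Context: $B_R\subset\mathbb{R}^3$ is the open ball of radius $R$ centered at the origin and $\Gamma=\partial B_R$ is the sphere of radius $R$. $S=\{\boldsymbol\alpha\in\mathbb{C}^3: |\boldsymbol\alpha|=1\}$ is the set of complex unit vectors. The dot $\cdot$ is the bilinear dot product $\boldsymbol u\cdot\boldsymbol v=\sum_i u_iv_i$ and $\times$ is the cross product extended bilinearly to $\mathbb{C}^3$. $\Delta_\Gamma$ is the Laplace-Beltrami operator on $\Gamma$, applied componentwise to vector-valued functions, and $(-\Delta_\Gamma)^0$ is the identity. For $\gamma\in\{0,2,4,\dots\}$, $\boldsymbol a\in L^2(\Gamma)^3$ and $\boldsymbol b\in H^{2\gamma}(\Gamma)^3$ (complex vector valued), $$\langle\boldsymbol a,\boldsymbol b\rangle_\gamma:=\int_\Gamma \boldsymbol a\cdot\overline{(-\Delta_\Gamma)^\gamma\boldsymbol b}\,d\Gamma,\qquad |\boldsymbol b|_\gamma=\langle\boldsymbol b,\boldsymbol b\rangle_\gamma^{1/2}=\left(\int_\Gamma|(-\Delta_\Gamma)^{\gamma/2}\boldsymbol b|^2\,d\Gamma\right)^{1/2}.$$ Let $G(\boldsymbol x,\boldsymbol y)=\frac{1}{4\pi|\boldsymbol x-\boldsymbol y|}$, so $\nabla_{\boldsymbol x}G(\boldsymbol x,\boldsymbol y)=-\frac{\boldsymbol x-\boldsymbol y}{4\pi|\boldsymbol x-\boldsymbol y|^3}$. For $\boldsymbol y,\boldsymbol z\in B_R$ and $\boldsymbol\alpha,\boldsymbol\beta\in S$, the point spread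 function with parameter $\gamma$ is $$K_{(\boldsymbol y,\boldsymbol\alpha)}(\boldsymbol z,\boldsymbol\beta):=\frac{\langle\nabla_{\boldsymbol x}G(\cdot,\boldsymbol y)\times\boldsymbol\alpha,\ \nabla_{\boldsymbol x}G(\cdot,\boldsymbol z)\times\boldsymbol\beta\rangle_\gamma}{|\nabla_{\boldsymbol x}G(\cdot,\boldsymbol z)\times\boldsymbol\beta|_\gamma},$$ where the functions are regarded as functions of $\boldsymbol x\in\Gamma$ and $\Delta_\Gamma$ acts in $\boldsymbol x$. (The denominator is nonzero.) *)

(* Defs.v *)
From Stdlib Require Import Reals Lra.
From Coquelicot Require Import Coquelicot.
Open Scope R_scope.

Definition R3 : Type := (R * R * R)%type.
Definition C3 : Type := (C * C * C)%type.

Definition pr1 {T : Type} (v : T * T * T) : T := fst (fst v).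
Definition pr2 {T : Type} (v : T * T * T) : T := snd (fst v).
Definition pr3 {T : Type} (v : T * T * T) : T := snd v.

Definition map3 {T U : Type} (f : T -> U) (v : T * T * T) : U * U * U :=
  (f (pr1 v), f (pr2 v), f (pr3 v)).

Definition zero3 : R3 := (0, 0, 0).
Definition e1 : R3 := (1, 0, 0).
Definition e2 : R3 := (0, 1, 0).
Definition e3 : R3 := (0, 0, 1).

Definition add3 (x y : R3) : R3 := (pr1 x + pr1 y, pr2 x + pr2 y, pr3 x + pr3 y).
Definition sub3 (x y : R3) : R3 := (pr1 x - pr1 y, pr2 x - pr2 y, pr3 x - pr3 y).
Definition scal3 (t : R) (x : R3) : R3 := (t * pr1 x, t * pr2 x, t * pr3 x).
Definition norm3 (x : R3) : R := sqrt (pr1 x ^ 2 + pr2 x ^ 2 + pr3 x ^ 2).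

Definition toC3 (x : R3) : C3 := map3 RtoC x.
Definition conj3 (u : C3) : C3 := map3 Cconj u.
Definition normC3 (u : C3) : R :=
  sqrt (Cmod (pr1 u) ^ 2 + Cmod (pr2 u) ^ 2 + Cmod (pr3 u) ^ 2).

(* Bilinear: there is no conjugation in [dot] nor in [cross]. *)
Definition dot (u v : C3) : C :=
  (pr1 u * pr1 v + pr2 u * pr2 v + pr3 u * pr3 v)%C.
Definition cross (u v : C3) : C3 :=
  ((pr2 u * pr3 v - pr3 u * pr2 v)%C,
   (pr3 u * pr1 v - pr1 u * pr3 v)%C,
   (pr1 u * pr2 v - pr2 u * pr1 v)%C).

Definition in_ball (r : R) (x : R3) : Prop := norm3 x < r.
Definition in_S (u : C3) : Prop := normC3 u = 1.

Definition sphere_pt (r theta phi : R) : R3 :=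
  (r * sin theta * cos phi, r * sin theta * sin phi, r * cos theta).

(* Surface integral over the sphere of radius r centered at 0, in spherical
   coordinates (area element r^2 sin theta dtheta dphi).  These are Riemann
   integrals, so they are meaningful for continuous integrands. *)
Definition surf_int (r : R) (f : R3 -> R) : R :=
  RInt (fun theta =>
    RInt (fun phi => f (sphere_pt r theta phi) * (r ^ 2 * sin theta)) 0 (2 * PI))
    0 PI.

Definition surf_intC (r : R) (f : R3 -> C) : C :=
  (surf_int r (fun x => Re (f x)), surf_int r (fun x => Im (f x))).

(* The Laplace-Beltrami operator of the sphere of radius r: at a point of the
   sphere it is the Euclidean Laplacian of the extension x |-> f (r x / |x|)
   of f, which is constant along rays. *)
Definition radial_ext (r : R) (f : R3 -> R) (x : R3) : R :=
  f (scal3 (r / norm3 x) x).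

Definition partial2 (e : R3) (f : R3 -> R) (x : R3) : R :=
  Derive_n (fun t => f (add3 x (scal3 t e))) 2 0.

Definition laplacian (f : R3 -> R) (x : R3) : R :=
  partial2 e1 f x + partial2 e2 f x + partial2 e3 f x.

Definition laplace_beltrami (r : R) (f : R3 -> R) (x : R3) : R :=
  laplacian (radial_ext r f) x.

Definition laplace_beltramiC (r : R) (f : R3 -> C) (x : R3) : C :=
  (laplace_beltrami r (fun y => Re (f y)) x,
   laplace_beltrami r (fun y => Im (f y)) x).

Definition neg_laplace_beltrami3 (r : R) (b : R3 -> C3) (x : R3) : C3 :=
  ((- laplace_beltramiC r (fun y => pr1 (b y)) x)%C,
   (- laplace_beltramiC r (fun y => pr2 (b y)) x)%C,
   (- laplace_beltramiC r (fun y => pr3 (b y)) x)%C).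

Definition neg_lb_pow (r : R) (k : nat) (b : R3 -> C3) : R3 -> C3 :=
  Nat.iter k (neg_laplace_beltrami3 r) b.

(* [inner_gamma] and [norm_gamma] are intended for even [gamma] only. *)
Definition inner_gamma (r : R) (gamma : nat) (a b : R3 -> C3) : C :=
  surf_intC r (fun x => dot (a x) (conj3 (neg_lb_pow r gamma b x))).

Definition norm_gamma (r : R) (gamma : nat) (b : R3 -> C3) : R :=
  sqrt (surf_int r (fun x => normC3 (neg_lb_pow r (Nat.div2 gamma) b x) ^ 2)).

Definition G (x y : R3) : R := / (4 * PI * norm3 (sub3 x y)).

Definition partial (e : R3) (f : R3 -> R) (x : R3) : R :=
  Derive (fun t => f (add3 x (scal3 t e))) 0.

Definition grad (f : R3 -> R) (x : R3) : R3 :=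
  (partial e1 f x, partial e2 f x, partial e3 f x).

Definition dipole_field (y : R3) (alpha : C3) (x : R3) : C3 :=
  cross (toC3 (grad (fun x' => G x' y) x)) alpha.

Definition psf (r : R) (gamma : nat) (y : R3) (alpha : C3) (z : R3) (beta : C3) : C :=
  (inner_gamma r gamma (dipole_field y alpha) (dipole_field z beta)
   / RtoC (norm_gamma r gamma (dipole_field z beta)))%C.

Definition D0 (r : R) (z : R3) : R :=
  r ^ 2 / (4 * PI * (r ^ 2 - norm3 z ^ 2) ^ 2).

Lemma norm_gamma_0_inner (r : R) (b : R3 -> C3) :
  norm_gamma r 0 b = sqrt (Re (inner_gamma r 0 b b)).
Proof.
unfold norm_gamma, inner_gamma, surf_intC, surf_int; simpl Re; f_equal.
apply RInt_ext; intros t _; apply RInt_ext; intros p _; f_equal.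
simpl Nat.div2; unfold neg_lb_pow; simpl Nat.iter.
set (v := b _); destruct v as [[[a1 b1] [a2 b2]] [a3 b3]].
unfold normC3, Cmod, dot, conj3, map3, Cconj, pr1, pr2, pr3; cbn [fst snd].
rewrite !pow2_sqrt by auto 10 using Rplus_le_le_0_compat, pow2_ge_0.
simpl; ring.
Qed.

Lemma grad_G (x y : R3) : x <> y ->
  grad (fun x' => G x' y) x
  = scal3 (- / (4 * PI * norm3 (sub3 x y) ^ 3)) (sub3 x y).
Proof.
destruct x as [[x1 x2] x3], y as [[y1 y2] y3]; intros Hxy.
assert (Hpos : 0 < (x1 - y1) ^ 2 + (x2 - y2) ^ 2 + (x3 - y3) ^ 2).
{ assert (P : forall u v : R, u <> v -> 0 < (u - v) ^ 2)
    by (intros u v Huv; apply pow2_gt_0; lra).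
  assert (Q1 := pow2_ge_0 (x1 - y1)); assert (Q2 := pow2_ge_0 (x2 - y2));
    assert (Q3 := pow2_ge_0 (x3 - y3)).
  destruct (Req_dec x1 y1) as [H1|H1]; [|assert (H := P _ _ H1); lra].
  destruct (Req_dec x2 y2) as [H2|H2]; [|assert (H := P _ _ H2); lra].
  destruct (Req_dec x3 y3) as [H3|H3]; [|assert (H := P _ _ H3); lra].
  now subst; destruct Hxy. }
assert (HPI := PI_RGT_0).
unfold grad, partial, G, norm3, add3, sub3, scal3, e1, e2, e3, pr1, pr2, pr3;
  cbn [fst snd].
set (s := sqrt _); assert (Hs : 0 < s) by (apply sqrt_lt_R0; exact Hpos).
assert (D : forall u v w : R,
  Derive (fun t => / (4 * PI * sqrt ((x1 + t * u - y1) ^ 2 + (x2 + t * v - y2) ^ 2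
     + (x3 + t * w - y3) ^ 2))) 0
  = - / (4 * PI * s ^ 3) * (u * (x1 - y1) + v * (x2 - y2) + w * (x3 - y3))).
{ intros u v w; apply is_derive_unique.
  assert (E : (x1 + 0 * u + - y1) * ((x1 + 0 * u + - y1) * 1)
     + (x2 + 0 * v + - y2) * ((x2 + 0 * v + - y2) * 1)
     + (x3 + 0 * w + - y3) * ((x3 + 0 * w + - y3) * 1)
     = (x1 - y1) ^ 2 + (x2 - y2) ^ 2 + (x3 - y3) ^ 2) by ring.
  auto_derive; rewrite E; fold s.
  - repeat split; auto.
    apply Rgt_not_eq; apply Rmult_lt_0_compat; [lra | exact Hs].
  - field; split; lra. }
rewrite !D; f_equal; [f_equal|]; ring.
Qed.

(* Main.v *)
(* On the sphere the two fields are [- cross x alpha / (4 pi r^3)] and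
   [- cross w beta / (4 pi |w|^3)] with [w = x - z], so that, splitting alpha and
   beta into real and imaginary parts, the numerator and the squared denominator
   are, up to constant factors, sums of integrals of

     ((x . w) (p . q) - (x . q) (p . w)) / |w|^3   and
     (|w|^2 |p|^2 - (w . p)^2) / |w|^6

   for real vectors p and q.  The surface integral is invariant under rotations,
   because the derivative along a rotation is a divergence in spherical
   coordinates; hence z may be taken on the polar axis, where the first integral
   is exactly [8 pi r / 3 (p . q)] and the second one is comparable to
   [|p|^2 / (r^2 - |z|^2)^2].  Thus [<. , .>_0 = (alpha . conj beta) / (6 pi r^2)],
   and the squared norm lies between [D0 / 72] and [D0]. *)
Require Import Defs.
From Stdlib Require Import Reals Lra ClassicalEpsilon.
From Coquelicot Require Import Coquelicot.
Open Scope R_scope.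

(** * Continuity of composite functions and of integrals with a parameter *)

Lemma continuous_Rplus {U : UniformSpace} (f g : U -> R) (x : U) :
  continuous f x -> continuous g x -> continuous (fun y => f y + g y) x.
Proof. exact (continuous_plus f g x). Qed.

Lemma continuous_Rminus {U : UniformSpace} (f g : U -> R) (x : U) :
  continuous f x -> continuous g x -> continuous (fun y => f y - g y) x.
Proof. exact (continuous_minus f g x). Qed.

Lemma continuous_Ropp {U : UniformSpace} (f : U -> R) (x : U) :
  continuous f x -> continuous (fun y => - f y) x.
Proof. exact (continuous_opp f x). Qed.

Lemma continuous_Rmult {U : UniformSpace} (f g : U -> R) (x : U) :
  continuous f x -> continuous g x -> continuous (fun y => f y * g y) x.
Proof. exact (continuous_mult f g x). Qed.

Lemma continuous_sin_comp {U : UniformSpace} (f : U -> R) (x : U) :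
  continuous f x -> continuous (fun y => sin (f y)) x.
Proof. intros H; exact (continuous_comp f sin x H (continuous_sin _)). Qed.

Lemma continuous_cos_comp {U : UniformSpace} (f : U -> R) (x : U) :
  continuous f x -> continuous (fun y => cos (f y)) x.
Proof. intros H; exact (continuous_comp f cos x H (continuous_cos _)). Qed.

Lemma continuous_fst_comp {U V W : UniformSpace} (f : U -> V * W) (x : U) :
  continuous f x -> continuous (fun y => fst (f y)) x.
Proof.
intros H; apply (continuous_comp f fst x H).
destruct (f x); apply continuous_fst.
Qed.

Lemma continuous_snd_comp {U V W : UniformSpace} (f : U -> V * W) (x : U) :
  continuous f x -> continuous (fun y => snd (f y)) x.
Proof.
intros H; apply (continuous_comp f snd x H).
destruct (f x); apply continuous_snd.
Qed.

Lemma continuous_pair {U V W : UniformSpace} (f : U -> V) (g : U -> W) (x : U) :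
  continuous f x -> continuous g x -> continuous (fun y => (f y, g y)) x.
Proof.
intros Hf Hg.
apply (continuous_comp_2 f g (fun a b => (a, b)) x Hf Hg).
apply (continuous_ext (fun p : V * W => p)).
- intros [a b]; reflexivity.
- apply continuous_id.
Qed.

Ltac cont := repeat lazymatch goal with
  | |- continuous (fun x => x) _ => apply continuous_id
  | |- continuous (fun _ => ?c) _ => apply continuous_const
  | |- continuous fst _ => apply (continuous_fst_comp (fun y => y))
  | |- continuous snd _ => apply (continuous_snd_comp (fun y => y))
  | |- continuous (fun _ => (_, _)) _ => apply continuous_pair
  | |- continuous (fun _ => _ + _) _ => apply continuous_Rplus
  | |- continuous (fun _ => _ - _) _ => apply continuous_Rminus
  | |- continuous (fun _ => - _) _ => apply continuous_Ropp
  | |- continuous (fun _ => _ * _) _ => apply continuous_Rmult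
  | |- continuous (fun _ => sin _) _ => apply continuous_sin_comp
  | |- continuous (fun _ => cos _) _ => apply continuous_cos_comp
  | |- continuous (fun _ => fst _) _ => apply continuous_fst_comp
  | |- continuous (fun _ => snd _) _ => apply continuous_snd_comp
  end.

(** Joint continuity makes [h] oscillate little near each [(u, t)], and compactness of [[a, b]]
    yields one radius around [u] valid for all [t], so the integrands are uniformly close. The
    parameter space is a general uniform space because the conservation argument below uses pairs
    (time, first coordinate). *)
Lemma continuous_RInt_param {U : UniformSpace} (h : U -> R -> R) (a b : R) (u : U) :
  a <= b ->
  (forall p : U * R, continuous (fun q : U * R => h (fst q) (snd q)) p) ->
  continuous (fun v => RInt (h v) a b) u.
Proof.
intros Hab Hh.
assert (Hsec : forall v t, continuous (h v) t).
{ intros v t.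
  apply (continuous_comp (fun t => (v, t)) (fun q : U * R => h (fst q) (snd q)));
    [cont | apply Hh]. }
assert (Hex : forall v, ex_RInt (h v) a b).
{ intros v; apply (ex_RInt_continuous (h v)); intros; apply Hsec. }
intros P [eps HP].
(* This choice gives [(b - a + 1) * e = eps / 2], hence [(b - a) * e < eps]; the added 1 keeps the
   divisor positive when [a = b]. *)
set (e := pos eps / (2 * (b - a + 1))).
assert (He : 0 < e).
{ apply Rdiv_lt_0_compat; [apply eps | lra]. }
(* Compactness takes the radius as a function of [t], hence the choice of a witness in an
   informative type. *)
assert (Hd : forall t, {d : posreal | forall v t', ball u d v -> ball t d t' ->
  Rabs (h v t' - h u t) < e / 2}).
{ intros t; apply constructive_indefinite_description.
  assert (He2 : 0 < e / 2) by lra.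
  destruct (Hh (u, t) (fun y => ball (h u t) (mkposreal _ He2) y)) as [d Hd].
  - exists (mkposreal _ He2); intros y Hy; exact Hy.
  - exists d; intros v t' Hv Ht'.
    exact (Hd (v, t') (conj Hv Ht')). }
destruct (compactness_value_1d a b (fun t => proj1_sig (Hd t))) as [d Hdd].
exists d; intros v Hv.
apply HP; change (Rabs (RInt (h v) a b - RInt (h u) a b) < eps).
replace (RInt (h v) a b - RInt (h u) a b)
  with (RInt (fun t => h v t - h u t) a b)
  by exact (RInt_minus (h v) (h u) a b (Hex v) (Hex u)).
apply Rle_lt_trans with ((b - a) * e).
- apply abs_RInt_le_const; [exact Hab | |].
  + exact (ex_RInt_minus (h v) (h u) a b (Hex v) (Hex u)).
  (* The compactness statement is doubly negated, so the bound is proved by contradiction. Both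
     [h v t] and [h u t] are then within [e / 2] of [h u t0], with [t0] the centre of a covering
     interval. *)
  + intros t Ht; apply Rnot_lt_le; intros Hlt.
    apply (Hdd t Ht); intros (t0 & Ht0 & Habs & Hle).
    destruct (Hd t0) as [d0 Hd0]; simpl in Habs, Hle.
    assert (B : ball t0 d0 t).
    { apply ball_sym; change (Rabs (t0 - t) < d0). rewrite Rabs_minus_sym; exact Habs. }
    assert (A1 := Hd0 v t (ball_le u d d0 Hle v Hv) B).
    assert (A2 := Hd0 u t (ball_center u d0) B).
    assert (A3 := Rabs_triang (h v t - h u t0) (- (h u t - h u t0))).
    rewrite Rabs_Ropp in A3.
    replace (h v t - h u t0 + - (h u t - h u t0)) with (h v t - h u t) in A3 by ring.
    lra.
- assert (E : (b - a + 1) * e = eps / 2) by (unfold e; field; lra).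
  assert (Heps := cond_pos eps); lra.
Qed.

Lemma continuous_section {U : UniformSpace} (h : U -> R -> R) (u : U) (t : R) :
  (forall p : U * R, continuous (fun q : U * R => h (fst q) (snd q)) p) ->
  continuous (h u) t.
Proof.
intros Hh.
apply (continuous_comp (fun t => (u, t)) (fun q : U * R => h (fst q) (snd q)));
  [cont | apply Hh].
Qed.

Lemma ex_RInt_section {U : UniformSpace} (h : U -> R -> R) (a b : R) (u : U) :
  (forall p : U * R, continuous (fun q : U * R => h (fst q) (snd q)) p) ->
  ex_RInt (h u) a b.
Proof.
intros Hh; apply (ex_RInt_continuous (h u)); intros t _.
now apply continuous_section.
Qed.

(** * Differentiation under the integral sign and conservation of mass *)

Lemma is_derive_RInt_param_cont (h dh : R -> R -> R) (a b u : R) :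
  (forall v t, is_derive (fun w => h w t) v (dh v t)) ->
  (forall p : R * R, continuous (fun q : R * R => h (fst q) (snd q)) p) ->
  (forall p : R * R, continuous (fun q : R * R => dh (fst q) (snd q)) p) ->
  is_derive (fun v => RInt (h v) a b) u (RInt (dh u) a b).
Proof.
intros Hd Hh Hdh.
replace (RInt (dh u) a b) with (RInt (fun t => Derive (fun v => h v t) u) a b)
  by (apply RInt_ext; intros t _; apply is_derive_unique, Hd).
apply is_derive_RInt_param.
- apply filter_forall; intros v t _; eexists; apply Hd.
- intros t _; apply continuity_2d_pt_filterlim.
  apply (continuous_ext (fun q : R * R => dh (fst q) (snd q))).
  + intros q; symmetry; apply is_derive_unique, Hd.
  + apply Hdh.
- apply filter_forall; intros v; now apply (ex_RInt_section h).
Qed.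

Lemma RInt_derive_cont (f df : R -> R) (a b : R) :
  (forall t, is_derive f t (df t)) -> (forall t, continuous df t) ->
  RInt df a b = f b - f a.
Proof.
intros Hf Hdf; apply is_RInt_unique, (is_RInt_derive f df); auto.
Qed.

Lemma is_derive_zero_const (f : R -> R) (s : R) :
  (forall t, is_derive f t 0) -> f s = f 0.
Proof.
intros Hf.
destruct (Rtotal_order s 0) as [H | [-> | H]]; [| reflexivity |].
- apply (eq_is_derive f s 0); [intros; apply Hf | exact H].
- symmetry; apply (eq_is_derive f 0 s); [intros; apply Hf | exact H].
Qed.

(* If the time derivative of a density is a divergence whose boundary fluxes
   vanish, then the total mass is conserved. *)
Lemma RInt2_conservation (h dh u du v dv : R -> R -> R -> R) (a b c d s : R) :
  a <= b -> c <= d ->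
  (forall p : R * R * R, continuous (fun q => h (pr1 q) (pr2 q) (pr3 q)) p) ->
  (forall p : R * R * R, continuous (fun q => u (pr1 q) (pr2 q) (pr3 q)) p) ->
  (forall p : R * R * R, continuous (fun q => du (pr1 q) (pr2 q) (pr3 q)) p) ->
  (forall p : R * R * R, continuous (fun q => dv (pr1 q) (pr2 q) (pr3 q)) p) ->
  (forall t x y, is_derive (fun t => h t x y) t (dh t x y)) ->
  (forall t x y, is_derive (fun x => u t x y) x (du t x y)) ->
  (forall t x y, is_derive (fun y => v t x y) y (dv t x y)) ->
  (forall t x y, dh t x y = du t x y + dv t x y) ->
  (forall t y, u t a y = u t b y) ->
  (forall t x, v t x c = v t x d) ->
  RInt (fun x => RInt (fun y => h s x y) c d) a b
  = RInt (fun x => RInt (fun y => h 0 x y) c d) a b.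
Proof.
intros Hab Hcd Ch Cu Cdu Cdv Dh Du Dv Hdiv Hu Hv.
assert (Cdh : forall p : R * R * R, continuous (fun q => dh (pr1 q) (pr2 q) (pr3 q)) p).
{ intros p.
  apply (continuous_ext (fun q => du (pr1 q) (pr2 q) (pr3 q) + dv (pr1 q) (pr2 q) (pr3 q))).
  - intros q; symmetry; apply Hdiv.
  - apply continuous_Rplus; [apply Cdu | apply Cdv]. }
assert (S : forall g : R -> R -> R -> R,
  (forall p : R * R * R, continuous (fun q => g (pr1 q) (pr2 q) (pr3 q)) p) ->
  forall t p, continuous (fun q : R * R => g t (fst q) (snd q)) p).
{ intros g Cg t p.
  assert (Ci : continuous (fun q : R * R => (t, fst q, snd q)) p) by cont.
  exact (continuous_comp _ _ p Ci (Cg _)). }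
assert (S' : forall g : R -> R -> R -> R,
  (forall p : R * R * R, continuous (fun q => g (pr1 q) (pr2 q) (pr3 q)) p) ->
  forall x p, continuous (fun q : R * R => g (fst q) x (snd q)) p).
{ intros g Cg x p.
  assert (Ci : continuous (fun q : R * R => (fst q, x, snd q)) p) by cont.
  exact (continuous_comp _ _ p Ci (Cg _)). }
assert (I : forall g : R -> R -> R -> R,
  (forall p : R * R * R, continuous (fun q => g (pr1 q) (pr2 q) (pr3 q)) p) ->
  forall p, continuous (fun q : R * R => RInt (g (fst q) (snd q)) c d) p).
{ intros g Cg p.
  apply (continuous_RInt_param (fun q : R * R => g (fst q) (snd q)) c d p Hcd Cg). }
apply (is_derive_zero_const (fun t => RInt (fun x => RInt (h t x) c d) a b)).
intros t.
replace 0 with (RInt (fun x => RInt (dh t x) c d) a b).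
- apply (is_derive_RInt_param_cont (fun t x => RInt (h t x) c d)
    (fun t x => RInt (dh t x) c d)).
  + intros t' x.
    apply (is_derive_RInt_param_cont (fun t y => h t x y) (fun t y => dh t x y));
      auto.
  + now apply I.
  + now apply I.
(* The inner integral of [dv] vanishes because [v] agrees at [c] and [d]. What remains is the
   integral of the [x]-derivative of the total [u], which vanishes because [u] agrees at [a] and
   [b]. *)
- rewrite (RInt_ext _ (fun x => RInt (du t x) c d)).
  + rewrite (RInt_derive_cont (fun x => RInt (u t x) c d)).
    * rewrite (RInt_ext (u t b) (u t a)); [apply Rminus_diag | intros; symmetry; apply Hu].
    * intros x; apply (is_derive_RInt_param_cont (u t) (du t)); auto.
    * intros x; apply (continuous_RInt_param (du t) c d x Hcd); auto.
  + intros x _.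
    rewrite (RInt_ext _ (fun y => du t x y + dv t x y)); [|intros; apply Hdiv].
    rewrite (RInt_plus (V := R_CompleteNormedModule) (du t x) (dv t x));
      [| apply (ex_RInt_section (du t)); auto | apply (ex_RInt_section (dv t)); auto].
    rewrite (RInt_derive_cont (v t x) (dv t x)), Hv; auto.
    * rewrite Rminus_diag; apply Rplus_0_r.
    * intros y; apply (continuous_section (dv t)); auto.
Qed.

(** * Rotation invariance of the surface integral *)

Definition on_sphere (r : R) (x : R3) : Prop :=
  pr1 x ^ 2 + pr2 x ^ 2 + pr3 x ^ 2 = r ^ 2.

Definition inner3 (u v : R3) : R := pr1 u * pr1 v + pr2 u * pr2 v + pr3 u * pr3 v.

Definition is_derive3 (c : R -> R3) (t : R) (d : R3) : Prop :=
  is_derive (fun u => pr1 (c u)) t (pr1 d) /\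
  is_derive (fun u => pr2 (c u)) t (pr2 d) /\
  is_derive (fun u => pr3 (c u)) t (pr3 d).

(* The derivative is tested along curves, so that the chain rule in spherical
   coordinates is immediate. *)
Definition sphere_C1 (r : R) (f : R * R * R -> R) : Prop :=
  exists D : R * R * R -> R * R * R, forall x, on_sphere r x ->
    continuous f x /\ continuous D x /\
    forall (c : R -> R3) (t : R) (d : R3), c t = x -> is_derive3 c t d ->
      is_derive (fun u => f (c u)) t (inner3 (D x) d).

Lemma is_derive_eq (f : R -> R) (t d d' : R) :
  is_derive f t d -> d = d' -> is_derive f t d'.
Proof. now intros H <-. Qed.

Lemma sphere_C1_const (r k : R) : sphere_C1 r (fun _ => k).
Proof.
exists (fun _ => zero3); intros x _.
split; [apply continuous_const | split; [apply continuous_const |]].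
intros c t d _ _; eapply is_derive_eq; [apply (is_derive_const (V := R_NormedModule)) |].
unfold inner3, zero3, pr1, pr2, pr3, zero; simpl; ring.
Qed.

Lemma sphere_C1_pr1 (r : R) : sphere_C1 r pr1.
Proof.
exists (fun _ => e1); intros x _.
split; [unfold pr1; cont | split; [apply continuous_const |]].
intros c t d _ (H & _ & _); eapply is_derive_eq; [exact H |].
unfold inner3, e1, pr1, pr2, pr3; simpl; ring.
Qed.

Lemma sphere_C1_pr2 (r : R) : sphere_C1 r pr2.
Proof.
exists (fun _ => e2); intros x _.
split; [unfold pr2; cont | split; [apply continuous_const |]].
intros c t d _ (_ & H & _); eapply is_derive_eq; [exact H |].
unfold inner3, e2, pr1, pr2, pr3; simpl; ring.
Qed.

Lemma sphere_C1_pr3 (r : R) : sphere_C1 r pr3.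
Proof.
exists (fun _ => e3); intros x _.
split; [unfold pr3; cont | split; [apply continuous_const |]].
intros c t d _ (_ & _ & H); eapply is_derive_eq; [exact H |].
unfold inner3, e3, pr1, pr2, pr3; simpl; ring.
Qed.

Lemma sphere_C1_plus (r : R) (f g : R3 -> R) :
  sphere_C1 r f -> sphere_C1 r g -> sphere_C1 r (fun x => f x + g x).
Proof.
intros (F & HF) (G & HG).
exists (fun x => add3 (F x) (G x)); intros x Hx.
destruct (HF x Hx) as (Cf & CF & Df), (HG x Hx) as (Cg & CG & Dg).
split; [cont; assumption | split; [unfold add3, pr1, pr2, pr3; cont; assumption |]].
intros c t d E H.
eapply is_derive_eq;
  [exact (is_derive_plus _ _ _ _ _ (Df c t d E H) (Dg c t d E H)) |].
unfold inner3, add3, pr1, pr2, pr3, plus; simpl; ring.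
Qed.

Lemma sphere_C1_mult (r : R) (f g : R3 -> R) :
  sphere_C1 r f -> sphere_C1 r g -> sphere_C1 r (fun x => f x * g x).
Proof.
intros (F & HF) (G & HG).
exists (fun x => add3 (scal3 (g x) (F x)) (scal3 (f x) (G x))); intros x Hx.
destruct (HF x Hx) as (Cf & CF & Df), (HG x Hx) as (Cg & CG & Dg).
split; [cont; assumption
  | split; [unfold add3, scal3, pr1, pr2, pr3; simpl; cont; assumption |]].
intros c t d E H.
eapply is_derive_eq;
  [exact (is_derive_mult _ _ _ _ _ (Df c t d E H) (Dg c t d E H) Rmult_comm) |].
cbv beta; rewrite E; unfold inner3, add3, scal3, pr1, pr2, pr3, plus, mult; simpl; ring.
Qed.

(** The conditions on [k] are limited to values taken on the sphere, so that [k] may be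
    [fun u => / sqrt u], singular at 0. *)
Lemma sphere_C1_comp (r : R) (k dk : R -> R) (f : R3 -> R) :
  (forall x, on_sphere r x -> is_derive k (f x) (dk (f x)) /\ continuous dk (f x)) ->
  sphere_C1 r f -> sphere_C1 r (fun x => k (f x)).
Proof.
intros Hk (F & HF).
exists (fun x => scal3 (dk (f x)) (F x)); intros x Hx.
destruct (HF x Hx) as (Cf & CF & Df), (Hk x Hx) as [Dk Ck].
assert (Cd : continuous (fun y : R * R * R => dk (f y)) x)
  by exact (continuous_comp f dk x Cf Ck).
split; [| split; [unfold scal3, pr1, pr2, pr3; cont; assumption |]].
- apply (continuous_comp f k x Cf), (ex_derive_continuous k); eexists; exact Dk.
- intros c t d <- H.
  eapply is_derive_eq; [exact (is_derive_comp k _ t _ _ Dk (Df c t d eq_refl H)) |].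
  unfold inner3, scal3, pr1, pr2, pr3, scal; simpl; unfold mult; simpl; ring.
Qed.

(** Equality is asked on the whole space since the curves in [sphere_C1] may leave the sphere. *)
Lemma sphere_C1_ext (r : R) (f g : R3 -> R) :
  (forall x, f x = g x) -> sphere_C1 r f -> sphere_C1 r g.
Proof.
intros E (D & H); exists D; intros x Hx; destruct (H x Hx) as (Cf & CD & Df).
split; [now apply (continuous_ext f) | split; [exact CD |]].
intros c t d Ec Hd; apply (is_derive_ext (fun u => f (c u))); auto.
Qed.

(** The index of [rot2] and [rot3] is that of the fixed axis. These two families suffice to carry
    the polar axis to any direction. *)
Definition rot2 (s : R) (x : R3) : R3 :=
  (cos s * pr1 x + sin s * pr3 x, pr2 x, cos s * pr3 x - sin s * pr1 x).

Definition rot3 (s : R) (x : R3) : R3 :=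
  (cos s * pr1 x - sin s * pr2 x, sin s * pr1 x + cos s * pr2 x, pr3 x).

Lemma cos2_sin2 (t : R) : cos t ^ 2 = 1 - sin t ^ 2.
Proof. assert (H := sin2_cos2 t); unfold Rsqr in H; lra. Qed.

Lemma on_sphere_pt (r theta phi : R) : on_sphere r (sphere_pt r theta phi).
Proof.
unfold on_sphere, sphere_pt, pr1, pr2, pr3; simpl fst; simpl snd.
ring_simplify; rewrite !cos2_sin2; ring.
Qed.

Lemma on_sphere_rot2 (r s : R) (x : R3) : on_sphere r x -> on_sphere r (rot2 s x).
Proof.
unfold on_sphere, rot2, pr1, pr2, pr3; simpl fst; simpl snd; intros <-.
ring_simplify; rewrite !cos2_sin2; ring.
Qed.

Lemma on_sphere_rot3 (r s : R) (x : R3) : on_sphere r x -> on_sphere r (rot3 s x).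
Proof.
unfold on_sphere, rot3, pr1, pr2, pr3; simpl fst; simpl snd; intros <-.
ring_simplify; rewrite !cos2_sin2; ring.
Qed.

(* The flow [Y] moves points along the tangent field with coordinates
   (a / sin theta, b / sin theta), and [da + db = 0] says that this field is
   divergence free. *)
Lemma surf_int_flow (r : R) (f : R3 -> R) (Y Yt Yh Yp : R -> R -> R -> R3)
  (a b da db : R -> R -> R) (s : R) :
  sphere_C1 r f ->
  (forall t th ph, on_sphere r (Y t th ph)) ->
  (forall p : R * R * R, continuous (fun q => Y (pr1 q) (pr2 q) (pr3 q) : R * R * R) p) ->
  (forall p : R * R * R, continuous (fun q => Yh (pr1 q) (pr2 q) (pr3 q) : R * R * R) p) ->
  (forall p : R * R * R, continuous (fun q => Yp (pr1 q) (pr2 q) (pr3 q) : R * R * R) p) ->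
  (forall t th ph, is_derive3 (fun u => Y u th ph) t (Yt t th ph)) ->
  (forall t th ph, is_derive3 (fun u => Y t u ph) th (Yh t th ph)) ->
  (forall t th ph, is_derive3 (fun u => Y t th u) ph (Yp t th ph)) ->
  (forall p : R * R * R, continuous (fun q => a (pr2 q) (pr3 q)) p) ->
  (forall p : R * R * R, continuous (fun q => b (pr2 q) (pr3 q)) p) ->
  (forall p : R * R * R, continuous (fun q => da (pr2 q) (pr3 q)) p) ->
  (forall p : R * R * R, continuous (fun q => db (pr2 q) (pr3 q)) p) ->
  (forall th ph, is_derive (fun u => a u ph) th (da th ph)) ->
  (forall th ph, is_derive (fun u => b th u) ph (db th ph)) ->
  (forall th ph, da th ph + db th ph = 0) ->
  (forall t th ph, scal3 (sin th) (Yt t th ph)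
    = add3 (scal3 (a th ph) (Yh t th ph)) (scal3 (b th ph) (Yp t th ph))) ->
  (forall ph, a 0 ph = 0) -> (forall ph, a PI ph = 0) ->
  (forall th, b th 0 = b th (2 * PI)) -> (forall t th, Y t th 0 = Y t th (2 * PI)) ->
  RInt (fun th => RInt (fun ph => f (Y s th ph) * (r ^ 2 * sin th)) 0 (2 * PI)) 0 PI
  = RInt (fun th => RInt (fun ph => f (Y 0 th ph) * (r ^ 2 * sin th)) 0 (2 * PI)) 0 PI.
Proof.
intros (D & Hf) HY CY CYh CYp DYt DYh DYp Ca Cb Cda Cdb Da Db Hdiv Htan Ha0 HaPI Hb HYp.
assert (Cf : forall p : R * R * R, continuous (fun q => f (Y (pr1 q) (pr2 q) (pr3 q))) p)
  by (intros p; apply (continuous_comp _ f p (CY p)), Hf, HY).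
assert (CD : forall p : R * R * R, continuous (fun q => D (Y (pr1 q) (pr2 q) (pr3 q))) p)
  by (intros p; apply (continuous_comp _ D p (CY p)), Hf, HY).
assert (Df : forall c t d, on_sphere r (c t) -> is_derive3 c t d ->
  is_derive (fun u => f (c u)) t (inner3 (D (c t)) d))
  by (intros c t d Hc; now apply Hf).
assert (HPI := PI_RGT_0).
(* The density [f(Y) r^2 sin th], multiplied by the velocity [(a / sin th, b / sin th)], gives the
   fluxes [f(Y) r^2 a] and [f(Y) r^2 b], which are regular at the poles. The first vanishes at both
   poles and the second is periodic in the longitude. *)
refine (RInt2_conservation (fun t th ph => f (Y t th ph) * (r ^ 2 * sin th))
 (fun t th ph => inner3 (D (Y t th ph)) (Yt t th ph) * (r ^ 2 * sin th))
 (fun t th ph => f (Y t th ph) * (r ^ 2 * a th ph))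
 (fun t th ph => inner3 (D (Y t th ph)) (Yh t th ph) * (r ^ 2 * a th ph)
    + f (Y t th ph) * (r ^ 2 * da th ph))
 (fun t th ph => f (Y t th ph) * (r ^ 2 * b th ph))
 (fun t th ph => inner3 (D (Y t th ph)) (Yp t th ph) * (r ^ 2 * b th ph)
    + f (Y t th ph) * (r ^ 2 * db th ph))
 0 PI 0 (2 * PI) s _ _ _ _ _ _ _ _ _ _ _ _); [lra | lra | | | | | | | | | |].
1-4: intros p; unfold inner3, pr1, pr2, pr3 in *; cont;
  try exact (Cf p); try exact (CD p); try exact (CYh p); try exact (CYp p);
  try exact (Ca p); try exact (Cb p); try exact (Cda p); try exact (Cdb p).
- intros t th ph; eapply is_derive_eq;
   [ apply (is_derive_mult _ _ t _ _ (Df (fun u => Y u th ph) t _ (HY _ _ _) (DYt t th ph))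
       (is_derive_const _ _) Rmult_comm)
   | unfold plus, mult, zero; simpl; ring].
- intros t th ph; eapply is_derive_eq;
   [ apply (is_derive_mult _ _ th _ _ (Df (fun u => Y t u ph) th _ (HY _ _ _) (DYh t th ph))
       (is_derive_scal _ _ _ _ (Da th ph)) Rmult_comm)
   | unfold plus, mult, zero; simpl; ring].
- intros t th ph; eapply is_derive_eq;
   [ apply (is_derive_mult _ _ ph _ _ (Df (fun u => Y t th u) ph _ (HY _ _ _) (DYp t th ph))
       (is_derive_scal _ _ _ _ (Db th ph)) Rmult_comm)
   | unfold plus, mult, zero; simpl; ring].
- intros t th ph.
  replace (db th ph) with (- da th ph) by (assert (H := Hdiv th ph); lra).
  assert (H := Htan t th ph); unfold add3, scal3, pr1, pr2, pr3 in H.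
  injection H as H1 H2 H3; unfold inner3, pr1, pr2, pr3; simpl in H1, H2, H3.
  transitivity (r ^ 2 *
   (fst (fst (D (Y t th ph))) * (sin th * fst (fst (Yt t th ph)))
   + snd (fst (D (Y t th ph))) * (sin th * snd (fst (Yt t th ph)))
   + snd (D (Y t th ph)) * (sin th * snd (Yt t th ph)))); [ring |].
  rewrite H1, H2, H3; ring.
- intros t ph; rewrite Ha0, HaPI; ring.
- intros t th; now rewrite Hb, HYp.
Qed.

(** Rotation about the second axis flows along [cos ph d/dth - cot th sin ph d/dph]. Multiplying
    these components by [sin th] gives the witnesses for [a] and [b]. They do not depend on time,
    since the flow is linear and carries the coordinate tangent vectors along with the point. *)
Lemma surf_int_rot2 (r s : R) (f : R3 -> R) : sphere_C1 r f ->
  surf_int r (fun x => f (rot2 s x)) = surf_int r f.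
Proof.
intros Hf; unfold surf_int.
rewrite (surf_int_flow r f (fun t th ph => rot2 t (sphere_pt r th ph))
  (fun t th ph => (pr3 (rot2 t (sphere_pt r th ph)), 0, - pr1 (rot2 t (sphere_pt r th ph))))
  (fun t th ph => rot2 t (r * cos th * cos ph, r * cos th * sin ph, - r * sin th))
  (fun t th ph => rot2 t (- r * sin th * sin ph, r * sin th * cos ph, 0))
  (fun th ph => sin th * cos ph) (fun th ph => - (cos th * sin ph))
  (fun th ph => cos th * cos ph) (fun th ph => - (cos th * cos ph))); [| exact Hf |..].
1: { apply RInt_ext; intros th _; apply RInt_ext; intros ph _.
  f_equal; f_equal; unfold rot2, sphere_pt, pr1, pr2, pr3; simpl.
  rewrite cos_0, sin_0; f_equal; [f_equal|]; ring. }
1: intros; apply on_sphere_rot2, on_sphere_pt.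
1-3, 7-10: intros p; unfold rot2, sphere_pt, pr1, pr2, pr3; simpl; cont.
1-3: intros; unfold is_derive3, rot2, sphere_pt, pr1, pr2, pr3; simpl;
  split; [| split]; auto_derive; try exact I; ring.
1-2: intros; auto_derive; try exact I; ring.
- intros; ring.
- intros t th ph; unfold add3, scal3, rot2, sphere_pt, pr1, pr2, pr3; simpl.
  f_equal; [f_equal |]; ring_simplify; rewrite ?cos2_sin2; ring.
- intros; rewrite sin_0; ring.
- intros; rewrite sin_PI; ring.
- intros; rewrite sin_0, sin_2PI; ring.
- intros; unfold sphere_pt; rewrite sin_0, sin_2PI, cos_0, cos_2PI; reflexivity.
Qed.

(** Here the flow is a shift of the longitude, along [d/dph], so that [a = 0] and [b = sin th]. *)
Lemma surf_int_rot3 (r s : R) (f : R3 -> R) : sphere_C1 r f ->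
  surf_int r (fun x => f (rot3 s x)) = surf_int r f.
Proof.
intros Hf; unfold surf_int.
rewrite (surf_int_flow r f (fun t th ph => rot3 t (sphere_pt r th ph))
  (fun t th ph => (- pr2 (rot3 t (sphere_pt r th ph)), pr1 (rot3 t (sphere_pt r th ph)), 0))
  (fun t th ph => rot3 t (r * cos th * cos ph, r * cos th * sin ph, - r * sin th))
  (fun t th ph => rot3 t (- r * sin th * sin ph, r * sin th * cos ph, 0))
  (fun _ _ => 0) (fun th _ => sin th) (fun _ _ => 0) (fun _ _ => 0)); [| exact Hf |..].
1: { apply RInt_ext; intros th _; apply RInt_ext; intros ph _.
  f_equal; f_equal; unfold rot3, sphere_pt, pr1, pr2, pr3; simpl.
  rewrite cos_0, sin_0; f_equal; f_equal; ring. }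
1: intros; apply on_sphere_rot3, on_sphere_pt.
1-3, 7-10: intros p; unfold rot3, sphere_pt, pr1, pr2, pr3; simpl; cont.
1-3: intros; unfold is_derive3, rot3, sphere_pt, pr1, pr2, pr3; simpl;
  split; [| split]; auto_derive; try exact I; ring.
1-2: intros; auto_derive; try exact I; ring.
- intros; ring.
- intros t th ph; unfold add3, scal3, rot3, sphere_pt, pr1, pr2, pr3; simpl.
  f_equal; [f_equal |]; ring.
- reflexivity.
- reflexivity.
- reflexivity.
- intros; unfold sphere_pt; rewrite sin_0, sin_2PI, cos_0, cos_2PI; reflexivity.
Qed.

(** * Moving a point of the ball to the polar axis *)

Lemma polar_coordinates (x y : R) :
  exists t, x = sqrt (x ^ 2 + y ^ 2) * cos t /\ y = sqrt (x ^ 2 + y ^ 2) * sin t.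
Proof.
set (m := sqrt (x ^ 2 + y ^ 2)).
assert (Hx := pow2_ge_0 x); assert (Hy := pow2_ge_0 y).
assert (Hm : m ^ 2 = x ^ 2 + y ^ 2) by (apply pow2_sqrt; lra).
assert (Hm0 : 0 <= m) by apply sqrt_pos.
destruct (Req_dec m 0) as [E | E].
- rewrite E in Hm |- *; exists 0.
  assert (x ^ 2 = 0) by lra; assert (y ^ 2 = 0) by lra.
  split; rewrite Rmult_0_l; apply Rsqr_0_uniq; unfold Rsqr; lra.
- assert (Hu : (x / m) ^ 2 + (y / m) ^ 2 = 1)
    by (field_simplify; [rewrite Hm; field; nra | exact E]).
  assert (B : -1 <= x / m <= 1).
  { assert (H := pow2_ge_0 (y / m)).
    split; nra. }
  assert (S : sin (acos (x / m)) ^ 2 = (y / m) ^ 2)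
    by (assert (H := sin2_cos2 (acos (x / m))); rewrite cos_acos in H by exact B;
        unfold Rsqr in H; lra).
  assert (S' : sin (acos (x / m)) = y / m \/ sin (acos (x / m)) = - (y / m)).
  { assert (Z : (sin (acos (x / m)) - y / m) * (sin (acos (x / m)) + y / m) = 0) by lra.
    apply Rmult_integral in Z; lra. }
  (* [acos] fixes the angle only up to sign; the sign of the sine decides between it and its
     opposite. *)
  destruct S' as [S' | S'].
  + exists (acos (x / m)); rewrite S', cos_acos by exact B; split; field; exact E.
  + exists (- acos (x / m)); rewrite sin_neg, cos_neg, S', cos_acos by exact B.
    split; field; exact E.
Qed.

Lemma inner3_rot2 (s : R) (u v : R3) : inner3 (rot2 s u) (rot2 s v) = inner3 u v.
Proof.
unfold inner3, rot2, pr1, pr2, pr3; simpl.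
ring_simplify; rewrite !cos2_sin2; ring.
Qed.

Lemma inner3_rot3 (s : R) (u v : R3) : inner3 (rot3 s u) (rot3 s v) = inner3 u v.
Proof.
unfold inner3, rot3, pr1, pr2, pr3; simpl.
ring_simplify; rewrite !cos2_sin2; ring.
Qed.

Lemma norm3_inner3 (x : R3) : norm3 x = sqrt (inner3 x x).
Proof. unfold norm3, inner3; f_equal; ring. Qed.

Lemma inner3_ge_0 (x : R3) : 0 <= inner3 x x.
Proof. unfold inner3; nra. Qed.

Lemma norm3_sq (x : R3) : norm3 x ^ 2 = inner3 x x.
Proof. rewrite norm3_inner3; apply pow2_sqrt, inner3_ge_0. Qed.

Lemma rot2_inv (s : R) (x : R3) : rot2 s (rot2 (- s) x) = x.
Proof.
destruct x as [[x1 x2] x3]; unfold rot2, pr1, pr2, pr3; simpl.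
rewrite sin_neg, cos_neg.
f_equal; [f_equal |]; ring_simplify; rewrite cos2_sin2; ring.
Qed.

Lemma rot3_inv (s : R) (x : R3) : rot3 s (rot3 (- s) x) = x.
Proof.
destruct x as [[x1 x2] x3]; unfold rot3, pr1, pr2, pr3; simpl.
rewrite sin_neg, cos_neg.
f_equal; f_equal; ring_simplify; rewrite cos2_sin2; ring.
Qed.

Lemma rot2_sub3 (s : R) (x y : R3) : sub3 (rot2 s x) (rot2 s y) = rot2 s (sub3 x y).
Proof.
unfold sub3, rot2, pr1, pr2, pr3; simpl; f_equal; [f_equal |]; ring.
Qed.

Lemma rot3_sub3 (s : R) (x y : R3) : sub3 (rot3 s x) (rot3 s y) = rot3 s (sub3 x y).
Proof.
unfold sub3, rot3, pr1, pr2, pr3; simpl; f_equal; f_equal; ring.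
Qed.

(** The polar angle of [(x, y)] is the longitude, and that of [(z, m)], with [m] the distance to the
    axis, is the colatitude. Rotating [(0, 0, rho)] by the colatitude with [rot2] and then by the
    longitude with [rot3] gives the point. *)
Lemma rotation_ind (r : R) (P : R3 -> Prop) :
  (forall rho, 0 <= rho < r -> P (0, 0, rho)) ->
  (forall s z, in_ball r z -> P z -> P (rot2 s z)) ->
  (forall s z, in_ball r z -> P z -> P (rot3 s z)) ->
  forall z, in_ball r z -> P z.
Proof.
intros Hax H2 H3 [[x y] z] Hz.
destruct (polar_coordinates x y) as (t & Hx & Hy); set (m := sqrt _) in Hx, Hy.
destruct (polar_coordinates z m) as (u & Hc & Hs); set (rho := sqrt _) in Hc, Hs.
assert (Hr : 0 <= rho < r).
{ split; [apply sqrt_pos |].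
  replace rho with (norm3 (x, y, z)); [exact Hz |].
  unfold norm3, rho, pr1, pr2, pr3; simpl fst; simpl snd; f_equal.
  unfold m; rewrite pow2_sqrt; nra. }
assert (E1 : (m, 0, z) = rot2 u (0, 0, rho)).
{ unfold rot2, pr1, pr2, pr3; simpl.
  f_equal; [f_equal |]; lra. }
assert (E2 : (x, y, z) = rot3 t (m, 0, z)).
{ unfold rot3, pr1, pr2, pr3; simpl.
  f_equal; f_equal; lra. }
assert (B0 : in_ball r (0, 0, rho)).
{ unfold in_ball; rewrite norm3_inner3.
  replace (inner3 (0, 0, rho) (0, 0, rho)) with (rho ^ 2)
    by (unfold inner3, pr1, pr2, pr3; simpl; ring).
  rewrite sqrt_pow2; apply Hr. }
rewrite E2; apply H3; rewrite E1.
- unfold in_ball; rewrite norm3_inner3, inner3_rot2, <- norm3_inner3; exact B0.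
- apply H2; auto.
Qed.

(** * Smoothness on the sphere of the distance to an interior point *)

Lemma sphere_dist_pos (r : R) (x z : R3) :
  on_sphere r x -> in_ball r z -> 0 < inner3 (sub3 x z) (sub3 x z).
Proof.
intros Hx Hz.
destruct (Rle_lt_or_eq_dec _ _ (inner3_ge_0 (sub3 x z))) as [H | H]; [exact H |].
exfalso.
assert (E : inner3 x x = inner3 z z).
{ assert (Q1 := Rle_0_sqr (pr1 x - pr1 z)); assert (Q2 := Rle_0_sqr (pr2 x - pr2 z));
    assert (Q3 := Rle_0_sqr (pr3 x - pr3 z)).
  unfold inner3, sub3 in H; change (0 = Rsqr (pr1 x - pr1 z) + Rsqr (pr2 x - pr2 z)
    + Rsqr (pr3 x - pr3 z)) in H.
  assert (pr1 x - pr1 z = 0) by (apply Rsqr_0_uniq; lra).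
  assert (pr2 x - pr2 z = 0) by (apply Rsqr_0_uniq; lra).
  assert (pr3 x - pr3 z = 0) by (apply Rsqr_0_uniq; lra).
  unfold inner3.
  replace (pr1 x) with (pr1 z) by lra; replace (pr2 x) with (pr2 z) by lra.
  now replace (pr3 x) with (pr3 z) by lra. }
assert (Hn := norm3_sq z); rewrite <- E in Hn.
assert (Hp : 0 <= norm3 z) by apply sqrt_pos.
unfold in_ball in Hz; unfold on_sphere in Hx; unfold inner3 in Hn; nra.
Qed.

Lemma sphere_C1_inner3 (r : R) (f g : R3 -> R3) :
  sphere_C1 r (fun x => pr1 (f x)) -> sphere_C1 r (fun x => pr2 (f x)) ->
  sphere_C1 r (fun x => pr3 (f x)) -> sphere_C1 r (fun x => pr1 (g x)) ->
  sphere_C1 r (fun x => pr2 (g x)) -> sphere_C1 r (fun x => pr3 (g x)) ->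
  sphere_C1 r (fun x => inner3 (f x) (g x)).
Proof.
intros; unfold inner3.
apply (sphere_C1_plus r (fun x => pr1 (f x) * pr1 (g x) + pr2 (f x) * pr2 (g x)));
  [apply (sphere_C1_plus r (fun x => pr1 (f x) * pr1 (g x))) |]; now apply sphere_C1_mult.
Qed.

Lemma sphere_C1_minus (r : R) (f g : R3 -> R) :
  sphere_C1 r f -> sphere_C1 r g -> sphere_C1 r (fun x => f x - g x).
Proof.
intros Hf Hg.
apply (sphere_C1_ext r (fun x => f x + (-1) * g x)); [intros; ring |].
apply sphere_C1_plus; [exact Hf |].
apply (sphere_C1_mult r (fun _ => -1)); [apply sphere_C1_const | exact Hg].
Qed.

Lemma sphere_C1_pow (r : R) (f : R3 -> R) (n : nat) :
  sphere_C1 r f -> sphere_C1 r (fun x => f x ^ n).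
Proof.
intros Hf; induction n as [| n IH]; simpl; [apply sphere_C1_const |].
now apply sphere_C1_mult.
Qed.

Lemma sphere_C1_sub3 (r : R) (z : R3) :
  sphere_C1 r (fun x => pr1 (sub3 x z)) /\ sphere_C1 r (fun x => pr2 (sub3 x z)) /\
  sphere_C1 r (fun x => pr3 (sub3 x z)).
Proof.
split; [| split].
- apply (sphere_C1_minus r pr1); [apply sphere_C1_pr1 | apply sphere_C1_const].
- apply (sphere_C1_minus r pr2); [apply sphere_C1_pr2 | apply sphere_C1_const].
- apply (sphere_C1_minus r pr3); [apply sphere_C1_pr3 | apply sphere_C1_const].
Qed.

Lemma sphere_C1_inv_dist (r : R) (z : R3) :
  in_ball r z -> sphere_C1 r (fun x => / norm3 (sub3 x z)).
Proof.
intros Hz.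
apply (sphere_C1_ext r (fun x => / sqrt (inner3 (sub3 x z) (sub3 x z)))).
{ intros; now rewrite norm3_inner3. }
destruct (sphere_C1_sub3 r z) as (S1 & S2 & S3).
apply (sphere_C1_comp r (fun u => / sqrt u) (fun u => - / (2 * (sqrt u * sqrt u ^ 2)))
  (fun x => inner3 (sub3 x z) (sub3 x z))); [| now apply sphere_C1_inner3].
intros x Hx; assert (H := sphere_dist_pos r x z Hx Hz).
assert (Hs := sqrt_lt_R0 _ H).
split.
- auto_derive; [repeat split; lra | field; lra].
- apply (ex_derive_continuous (fun u => - / (2 * (sqrt u * sqrt u ^ 2)))).
  auto_derive; repeat split; auto; apply Rgt_not_eq;
    repeat apply Rmult_lt_0_compat; lra.
Qed.

(** * The two integrals *)

(** With [w = x - z], Lagrange's identity makes the bracket equal to [(x × p) . (w × q)], and the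
    one in [den_density] equal to [|w × p|^2]. Powers of the inverse norm replace quotients so that
    smoothness follows from the closure rules. *)
Definition num_density (z p q x : R3) : R :=
  (inner3 x (sub3 x z) * inner3 p q - inner3 x q * inner3 p (sub3 x z))
  * (/ norm3 (sub3 x z)) ^ 3.

Definition den_density (z p x : R3) : R :=
  (inner3 (sub3 x z) (sub3 x z) * inner3 p p - inner3 (sub3 x z) p ^ 2)
  * (/ norm3 (sub3 x z)) ^ 6.

Ltac sphere_C1_solve r z Hz :=
  destruct (sphere_C1_sub3 r z) as (? & ? & ?);
  assert (Hd := sphere_C1_inv_dist r z Hz);
  repeat lazymatch goal with
  | |- sphere_C1 _ (fun _ => ?c) => apply sphere_C1_const
  | |- sphere_C1 _ (fun _ => _ - _) => apply sphere_C1_minus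
  | |- sphere_C1 _ (fun _ => _ * _) => apply sphere_C1_mult
  | |- sphere_C1 _ (fun _ => _ ^ _) => apply sphere_C1_pow
  | |- sphere_C1 _ (fun _ => inner3 _ _) => apply sphere_C1_inner3
  | |- sphere_C1 _ (fun x => pr1 x) => apply sphere_C1_pr1
  | |- sphere_C1 _ (fun x => pr2 x) => apply sphere_C1_pr2
  | |- sphere_C1 _ (fun x => pr3 x) => apply sphere_C1_pr3
  | |- _ => assumption
  end.

Lemma sphere_C1_num_density (r : R) (z p q : R3) :
  in_ball r z -> sphere_C1 r (num_density z p q).
Proof. intros Hz; unfold num_density; sphere_C1_solve r z Hz. Qed.

Lemma sphere_C1_den_density (r : R) (z p : R3) :
  in_ball r z -> sphere_C1 r (den_density z p).
Proof. intros Hz; unfold den_density; sphere_C1_solve r z Hz. Qed.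

(* Coquelicot often leaves equations at the carrier of a normed module, on which
   [ring] and [field] fail. *)
Ltac R_eq := match goal with |- @eq _ ?x ?y => change (@eq R x y) end.

(** For [z] on the polar axis both densities are trigonometric polynomials of degree two in the
    longitude; [k] collects the factors that depend on the colatitude alone. *)
Lemma RInt_trig (k a b c d e g : R) :
  RInt (fun t => (a + b * cos t + c * sin t + d * cos t ^ 2 + e * (cos t * sin t)
    + g * sin t ^ 2) * k) 0 (2 * PI) = (2 * a + d + g) * PI * k.
Proof.
rewrite (RInt_derive_cont (fun t => (a * t + b * sin t - c * cos t
  + d * (t + sin t * cos t) / 2 + e * sin t ^ 2 / 2 + g * (t - sin t * cos t) / 2) * k)).
- rewrite sin_2PI, cos_2PI, sin_0, cos_0; apply Rminus_diag_uniq; field.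
- intros t; auto_derive; [exact I |].
  field_simplify; rewrite ?cos2_sin2; field.
- intros t; apply (ex_derive_continuous (V := R_NormedModule)); auto_derive; exact I.
Qed.

(** * The integrals for z on the polar axis *)

Section Axis.

Variables (r rho : R).
Hypotheses (Hrho : 0 <= rho < r).

(** By the law of cosines, the squared distance from [(0, 0, rho)] to the points of the sphere of
    colatitude [t]. *)
Let W2 (t : R) : R := r ^ 2 + rho ^ 2 - 2 * r * rho * cos t.

Lemma axis_W2_pos (t : R) : 0 < W2 t.
Proof.
assert (H := COS_bound t); unfold W2.
assert (0 <= r * rho * (1 - cos t)) by (repeat apply Rmult_le_pos; lra).
assert (0 < (r - rho) ^ 2) by (apply pow_lt; lra); lra.
Qed.

Lemma axis_sub3 (t p : R) : sub3 (sphere_pt r t p) (0, 0, rho)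
  = (r * sin t * cos p, r * sin t * sin p, r * cos t - rho).
Proof.
unfold sub3, sphere_pt, pr1, pr2, pr3; simpl; now rewrite !Rminus_0_r.
Qed.

Lemma axis_norm3 (t p : R) : norm3 (sub3 (sphere_pt r t p) (0, 0, rho)) = sqrt (W2 t).
Proof.
rewrite axis_sub3; unfold norm3, W2, pr1, pr2, pr3; simpl fst; simpl snd; f_equal.
ring_simplify; rewrite !cos2_sin2; ring.
Qed.

Lemma num_density_axis (p q : R3) :
  surf_int r (num_density (0, 0, rho) p q)
  = RInt (fun t => 2 * PI * r ^ 2 *
     ((pr1 p * pr1 q + pr2 p * pr2 q)
       * (sin t * (r ^ 2 - r * rho * cos t) / sqrt (W2 t) ^ 3
          - sin t * (r * sin t) ^ 2 / (2 * sqrt (W2 t) ^ 3))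
      + 2 * (pr3 p * pr3 q) * (sin t * (r * sin t) ^ 2 / (2 * sqrt (W2 t) ^ 3)))) 0 PI.
Proof.
unfold surf_int; apply RInt_ext; intros t _.
assert (HW := sqrt_lt_R0 _ (axis_W2_pos t)).
destruct p as [[p1 p2] p3], q as [[q1 q2] q3].
rewrite (RInt_ext _ (fun u =>
  ((r ^ 2 - r * rho * cos t) * (p1 * q1 + p2 * q2 + p3 * q3)
     - r * cos t * (r * cos t - rho) * (p3 * q3)
   + (- r * sin t * (q1 * (r * cos t - rho) * p3 + p1 * (r * cos t) * q3)) * cos u
   + (- r * sin t * (q2 * (r * cos t - rho) * p3 + p2 * (r * cos t) * q3)) * sin u
   + (- (r * sin t) ^ 2 * (p1 * q1)) * cos u ^ 2
   + (- (r * sin t) ^ 2 * (p1 * q2 + p2 * q1)) * (cos u * sin u)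
   + (- (r * sin t) ^ 2 * (p2 * q2)) * sin u ^ 2)
   * (/ sqrt (W2 t) ^ 3 * (r ^ 2 * sin t)))).
- rewrite RInt_trig; unfold pr1, pr2, pr3; simpl fst; simpl snd.
  apply Rminus_diag_uniq; field_simplify; [|lra].
  rewrite !cos2_sin2; field; lra.
- intros u _; unfold num_density; rewrite axis_norm3, axis_sub3.
  unfold inner3, sphere_pt, pr1, pr2, pr3; simpl fst; simpl snd.
  rewrite pow_inv; R_eq.
  transitivity
   ((((r * sin t) ^ 2 * (cos u ^ 2 + sin u ^ 2) + r * cos t * (r * cos t - rho))
      * (p1 * q1 + p2 * q2 + p3 * q3)
    - (r * sin t * (cos u * q1 + sin u * q2) + r * cos t * q3)
      * (p1 * (r * sin t * cos u) + p2 * (r * sin t * sin u) + p3 * (r * cos t - rho)))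
    * (/ sqrt (W2 t) ^ 3 * (r ^ 2 * sin t))); [ring |].
  f_equal.
  replace ((r * sin t) ^ 2 * (cos u ^ 2 + sin u ^ 2) + r * cos t * (r * cos t - rho))
    with (r ^ 2 - r * rho * cos t)
    by (rewrite cos2_sin2; ring_simplify; rewrite cos2_sin2; ring).
  ring.
Qed.

Lemma den_density_axis (p : R3) :
  surf_int r (den_density (0, 0, rho) p)
  = RInt (fun t => PI * r ^ 2 * sin t *
     (2 * (r * sin t) ^ 2 * pr3 p ^ 2
      + ((r * sin t) ^ 2 + 2 * (r * cos t - rho) ^ 2) * (pr1 p ^ 2 + pr2 p ^ 2))
      / W2 t ^ 3) 0 PI.
Proof.
unfold surf_int; apply RInt_ext; intros t _.
assert (HW := axis_W2_pos t).
destruct p as [[p1 p2] p3].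
rewrite (RInt_ext _ (fun u =>
  (W2 t * (p1 ^ 2 + p2 ^ 2 + p3 ^ 2) - (r * cos t - rho) ^ 2 * p3 ^ 2
   + (- 2 * (r * sin t) * (r * cos t - rho) * p1 * p3) * cos u
   + (- 2 * (r * sin t) * (r * cos t - rho) * p2 * p3) * sin u
   + (- (r * sin t) ^ 2 * p1 ^ 2) * cos u ^ 2
   + (- 2 * (r * sin t) ^ 2 * (p1 * p2)) * (cos u * sin u)
   + (- (r * sin t) ^ 2 * p2 ^ 2) * sin u ^ 2)
   * (/ W2 t ^ 3 * (r ^ 2 * sin t)))).
- rewrite RInt_trig; unfold pr1, pr2, pr3; simpl fst; simpl snd.
  replace ((r * sin t) ^ 2) with (W2 t - (r * cos t - rho) ^ 2)
    by (unfold W2; ring_simplify; rewrite ?cos2_sin2; ring).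
  R_eq; field; lra.
- intros u _; unfold den_density; rewrite <- norm3_sq, axis_norm3, axis_sub3.
  rewrite pow2_sqrt by lra.
  unfold inner3, sphere_pt, pr1, pr2, pr3; simpl fst; simpl snd.
  replace ((/ sqrt (W2 t)) ^ 6) with (/ W2 t ^ 3).
  + R_eq; ring.
  + rewrite pow_inv; f_equal.
    change 6%nat with (2 * 3)%nat; rewrite pow_mult, pow2_sqrt; lra.
Qed.

Lemma axis_dist_0 : sqrt (W2 0) = r - rho.
Proof.
replace (W2 0) with ((r - rho) ^ 2) by (unfold W2; rewrite cos_0; ring).
apply sqrt_pow2; lra.
Qed.

Lemma axis_dist_PI : sqrt (W2 PI) = r + rho.
Proof.
replace (W2 PI) with ((r + rho) ^ 2) by (unfold W2; rewrite cos_PI; ring).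
apply sqrt_pow2; lra.
Qed.

(** This is Gauss's law: the integrand comes from [x . w / |w|^3], which is [r] times the flux
    density of a point source at [z], so the value is independent of [rho]. *)
Lemma axis_flux_primitive : exists F : R -> R,
  (forall t, is_derive F t (sin t * (r ^ 2 - r * rho * cos t) / sqrt (W2 t) ^ 3)) /\
  F PI - F 0 = 2 / r.
Proof.
exists (fun t => - (r * cos t - rho) / (r * sqrt (W2 t))); split.
- intros t; assert (H := axis_W2_pos t); assert (Hs := sqrt_lt_R0 _ H).
  assert (Hsq : sqrt (W2 t) ^ 2 = W2 t) by (apply pow2_sqrt; lra).
  unfold W2 in *; auto_derive; [repeat split; auto; apply Rgt_not_eq;
      repeat apply Rmult_lt_0_compat; first [exact Hs | lra] |].
  replace (r ^ 2 + rho ^ 2 + - (2 * r * rho * cos t))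
    with (r ^ 2 + rho ^ 2 - 2 * r * rho * cos t) by ring.
  set (w := sqrt _) in *.
  apply Rminus_diag_uniq; field_simplify; [| lra].
  rewrite Hsq; field; lra.
- rewrite axis_dist_0, axis_dist_PI, cos_0, cos_PI; field; lra.
Qed.

(** For [rho <> 0], one integration by parts against the derivative of [1 / |w|] leaves a multiple
    of [sin t cos t / |w|], which becomes a polynomial in the variable [|w|]. The result divides by
    [rho ^ 3], so the centre is treated apart. *)
Lemma axis_transverse_primitive : exists F : R -> R,
  (forall t, is_derive F t (sin t * (r * sin t) ^ 2 / (2 * sqrt (W2 t) ^ 3))) /\
  F PI - F 0 = 2 / (3 * r).
Proof.
destruct (Req_dec rho 0) as [E | E].
- exists (fun t => (cos t ^ 3 / 3 - cos t) / (2 * r)); split.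
  + intros t; replace (sqrt (W2 t)) with r.
    * auto_derive; [repeat split; auto; lra |].
      apply Rminus_diag_uniq; field_simplify; [| lra].
      rewrite cos2_sin2; field; lra.
    * replace (W2 t) with (r ^ 2) by (unfold W2; rewrite E; ring).
      symmetry; apply sqrt_pow2; lra.
  + rewrite cos_0, cos_PI; field; lra.
- exists (fun t => - (r * sin t ^ 2 / (2 * rho * sqrt (W2 t)))
    + sqrt (W2 t) * (r ^ 2 + rho ^ 2 + r * rho * cos t) / (3 * r * rho ^ 3)); split.
  + intros t; assert (H := axis_W2_pos t); assert (Hs := sqrt_lt_R0 _ H).
    assert (Hsq : sqrt (W2 t) ^ 2 = W2 t) by (apply pow2_sqrt; lra).
    unfold W2 in *; auto_derive; [repeat split; auto; apply Rgt_not_eq;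
      repeat apply Rmult_lt_0_compat; first [exact Hs | lra] |].
    replace (r ^ 2 + rho ^ 2 + - (2 * r * rho * cos t))
      with (r ^ 2 + rho ^ 2 - 2 * r * rho * cos t) by ring.
    set (w := sqrt _) in *.
    apply Rminus_diag_uniq; field_simplify; [| lra].
    replace (w ^ 4) with (w ^ 2 * w ^ 2) by ring; rewrite Hsq; field; lra.
  + rewrite axis_dist_0, axis_dist_PI, sin_0, sin_PI, cos_0, cos_PI; field; lra.
Qed.

(** The transverse products get the coefficient [2 / r - 2 / (3 r)] and the axial one
    [2 * (2 / (3 r))]. Both equal [4 / (3 r)], so the full scalar product reappears. *)
Lemma num_integral_axis (p q : R3) :
  surf_int r (num_density (0, 0, rho) p q) = 8 * PI * r / 3 * inner3 p q.
Proof.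
destruct axis_flux_primitive as (F & DF & EF), axis_transverse_primitive as (H & DH & EH).
rewrite num_density_axis.
rewrite (RInt_derive_cont (fun t => 2 * PI * r ^ 2 *
     ((pr1 p * pr1 q + pr2 p * pr2 q) * (F t - H t) + 2 * (pr3 p * pr3 q) * H t))).
- R_eq.
  transitivity (2 * PI * r ^ 2 * ((pr1 p * pr1 q + pr2 p * pr2 q)
    * ((F PI - F 0) - (H PI - H 0)) + 2 * (pr3 p * pr3 q) * (H PI - H 0))); [ring |].
  rewrite EF, EH; unfold inner3; field; lra.
- intros t.
  assert (DF' : ex_derive F t) by (eexists; apply DF).
  assert (DH' : ex_derive H t) by (eexists; apply DH).
  auto_derive; [auto |].
  rewrite (is_derive_unique F t _ (DF t) : Derive (fun x : R => F x) t = _).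
  rewrite (is_derive_unique H t _ (DH t) : Derive (fun x : R => H x) t = _); ring.
- intros t; apply (ex_derive_continuous (V := R_NormedModule)).
  assert (H0 := axis_W2_pos t); assert (Hs := sqrt_lt_R0 _ H0); unfold W2 in *.
  auto_derive; repeat split; auto; apply Rgt_not_eq;
    repeat apply Rmult_lt_0_compat; first [exact Hs | lra].
Qed.

Lemma RInt_inv_dist4 : RInt (fun t => sin t / W2 t ^ 2) 0 PI = 2 / (r ^ 2 - rho ^ 2) ^ 2.
Proof.
assert (HD : 0 < r ^ 2 - rho ^ 2) by nra.
(* This primitive differs by a constant from [- 1 / (2 r rho W2)] when [rho <> 0], and it also
   covers [rho = 0]. *)
rewrite (RInt_derive_cont (fun t => (1 - cos t) / ((r - rho) ^ 2 * W2 t))).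
- R_eq; unfold W2; rewrite cos_0, cos_PI.
  replace (r ^ 2 + rho ^ 2 - 2 * r * rho * -1) with ((r + rho) ^ 2) by ring.
  replace (r ^ 2 + rho ^ 2 - 2 * r * rho * 1) with ((r - rho) ^ 2) by ring.
  replace (r ^ 2 - rho ^ 2) with ((r - rho) * (r + rho)) by ring.
  field; lra.
- intros t; assert (H := axis_W2_pos t).
  assert (E : W2 t = (r - rho) ^ 2 + 2 * r * rho * (1 - cos t)) by (unfold W2; ring).
  unfold W2 in H, E |- *.
  auto_derive; [apply Rgt_not_eq; repeat apply Rmult_lt_0_compat; first [exact H | lra] |].
  field; split; [| lra]; apply Rgt_not_eq; exact H.
- intros t; apply (ex_derive_continuous (V := R_NormedModule)).
  assert (H := axis_W2_pos t); unfold W2 in *.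
  auto_derive; repeat split; apply Rgt_not_eq;
    repeat apply Rmult_lt_0_compat; first [exact H | lra].
Qed.

(* On the hemisphere facing z, [W2 t <= (r - rho)^2 + 2 r^2 (1 - cos t)] and
   [sin t ^ 2 >= 1 - cos t], so this integral bounds that of [sin t ^ 3 / W2 t ^ 3]
   from below; unlike the latter it has a rational primitive in [cos t]. *)
Lemma RInt_near_pole :
  RInt (fun t => sin t * (1 - cos t) / ((r - rho) ^ 2 + 2 * r ^ 2 * (1 - cos t)) ^ 3) 0 (PI / 2)
  = / (2 * (r - rho) ^ 2 * ((r - rho) ^ 2 + 2 * r ^ 2) ^ 2).
Proof.
assert (Hm : 0 < (r - rho) ^ 2) by (apply pow_lt; lra).
assert (HP : forall t, 0 < (r - rho) ^ 2 + 2 * r ^ 2 * (1 - cos t)).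
{ intros t; assert (H := COS_bound t).
  assert (0 <= 2 * r ^ 2 * (1 - cos t)) by (apply Rmult_le_pos; nra); lra. }
(* With [s = 1 - cos t], [m = r - rho] and [B = m^2 + 2 r^2 s], the quotient [s / B] has derivative
   [m^2 / B^2] in [s], so [(s / B)^2 / (2 m^2)] is a primitive of [s / B^3]. *)
rewrite (RInt_derive_cont (fun t => (1 - cos t) ^ 2
  / (2 * (r - rho) ^ 2 * ((r - rho) ^ 2 + 2 * r ^ 2 * (1 - cos t)) ^ 2))).
- R_eq; rewrite cos_0, cos_PI2.
  assert (H0 := HP 0); assert (H1 := HP (PI / 2)); rewrite cos_0 in H0; rewrite cos_PI2 in H1.
  field; lra.
- intros t; assert (H := HP t).
  auto_derive; [apply Rgt_not_eq; repeat apply Rmult_lt_0_compat; first [exact H | lra] |].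
  field; split; [apply Rgt_not_eq; exact H | lra].
- intros t; apply (ex_derive_continuous (V := R_NormedModule)); assert (H := HP t).
  auto_derive; repeat split; apply Rgt_not_eq;
    repeat apply Rmult_lt_0_compat; first [exact H | lra].
Qed.

(** The bracket of the integrand lies between [(r sin t)^2 |p|^2] and [2 W2 |p|^2]. The upper bound
    leads to [RInt_inv_dist4]; for the lower one the hemisphere away from [z] is discarded and
    [RInt_near_pole] applies. *)
Lemma den_integral_axis (p : R3) :
  r ^ 2 * PI / 18 / (r ^ 2 - rho ^ 2) ^ 2 * inner3 p p
    <= surf_int r (den_density (0, 0, rho) p)
    <= 4 * PI * r ^ 2 / (r ^ 2 - rho ^ 2) ^ 2 * inner3 p p.
Proof.
rewrite den_density_axis.
set (g := fun t : R => _).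
assert (HPI := PI_RGT_0).
assert (Hm : 0 < (r - rho) ^ 2) by (apply pow_lt; lra).
assert (Hr2 : 0 < r ^ 2) by (apply pow_lt; lra).
assert (HD : 0 < r ^ 2 - rho ^ 2) by nra.
assert (Hpp := inner3_ge_0 p).
assert (Cg : forall t, continuous g t).
{ intros t; apply (ex_derive_continuous (V := R_NormedModule)).
  assert (H := axis_W2_pos t); unfold g, W2 in *.
  auto_derive; repeat split; apply Rgt_not_eq;
    repeat apply Rmult_lt_0_compat; first [exact H | lra]. }
assert (Ig : forall a b, ex_RInt g a b)
  by (intros; apply (ex_RInt_continuous g); intros; apply Cg).
assert (Cquarter : forall t, continuous (fun t =>
   sin t * (1 - cos t) / ((r - rho) ^ 2 + 2 * r ^ 2 * (1 - cos t)) ^ 3) t).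
{ intros t; apply (ex_derive_continuous (V := R_NormedModule)).
  assert (H := COS_bound t).
  assert (H' : 0 < (r - rho) ^ 2 + 2 * r ^ 2 * (1 - cos t))
    by (assert (0 <= 2 * r ^ 2 * (1 - cos t)) by (apply Rmult_le_pos; lra); lra).
  auto_derive; repeat split; apply Rgt_not_eq;
    repeat apply Rmult_lt_0_compat; first [exact H' | lra]. }
assert (Clow : forall t, continuous (fun t => PI * r ^ 4 * inner3 p p *
   (sin t * (1 - cos t) / ((r - rho) ^ 2 + 2 * r ^ 2 * (1 - cos t)) ^ 3)) t)
  by (intros t; apply (continuous_Rmult (fun _ => _)); [apply continuous_const | apply Cquarter]).
assert (Cinv4 : forall t, continuous (fun t => sin t / W2 t ^ 2) t).
{ intros t; apply (ex_derive_continuous (V := R_NormedModule)).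
  assert (H := axis_W2_pos t); unfold W2 in *.
  auto_derive; repeat split; apply Rgt_not_eq;
    repeat apply Rmult_lt_0_compat; first [exact H | lra]. }
assert (Cup : forall t, continuous (fun t => 2 * PI * r ^ 2 * inner3 p p *
   (sin t / W2 t ^ 2)) t)
  by (intros t; apply (continuous_Rmult (fun _ => _)); [apply continuous_const | apply Cinv4]).
assert (Hg : forall t, g t = PI * r ^ 2 * sin t *
  (2 * (r * sin t) ^ 2 * pr3 p ^ 2
   + (W2 t + (r * cos t - rho) ^ 2) * (pr1 p ^ 2 + pr2 p ^ 2)) / W2 t ^ 3).
{ intros t; unfold g; do 4 f_equal.
  unfold W2; ring_simplify; rewrite cos2_sin2; ring. }
assert (HW2 : forall t, W2 t = (r * sin t) ^ 2 + (r * cos t - rho) ^ 2)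
  by (intros t; unfold W2; ring_simplify; rewrite cos2_sin2; ring).
split.
- assert (P1 := pow2_ge_0 (pr1 p)); assert (P2 := pow2_ge_0 (pr2 p));
    assert (P3 := pow2_ge_0 (pr3 p)).
  assert (Epp : inner3 p p = pr1 p ^ 2 + pr2 p ^ 2 + pr3 p ^ 2) by (unfold inner3; ring).
  assert (Hbr : forall t, (r * sin t) ^ 2 * inner3 p p <=
    2 * (r * sin t) ^ 2 * pr3 p ^ 2
    + (W2 t + (r * cos t - rho) ^ 2) * (pr1 p ^ 2 + pr2 p ^ 2)).
  { intros t; rewrite HW2, Epp.
    assert (A := pow2_ge_0 (r * sin t)); assert (B := pow2_ge_0 (r * cos t - rho)); nra. }
  assert (Hg0 : forall t, 0 <= sin t -> PI * r ^ 2 * sin t * ((r * sin t) ^ 2 * inner3 p p)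
    / W2 t ^ 3 <= g t).
  { intros t Ht; rewrite Hg; assert (H := axis_W2_pos t).
    apply Rmult_le_compat_r; [apply Rlt_le, Rinv_0_lt_compat, pow_lt, H |].
    apply Rmult_le_compat_l; [apply Rmult_le_pos; [apply Rmult_le_pos |]; lra | apply Hbr]. }
  assert (Hfst : PI * r ^ 4 * inner3 p p * RInt (fun t => sin t * (1 - cos t)
      / ((r - rho) ^ 2 + 2 * r ^ 2 * (1 - cos t)) ^ 3) 0 (PI / 2) <= RInt g 0 (PI / 2)).
  { replace (PI * r ^ 4 * inner3 p p * RInt _ 0 (PI / 2)) with
      (RInt (fun t => PI * r ^ 4 * inner3 p p * (sin t * (1 - cos t)
        / ((r - rho) ^ 2 + 2 * r ^ 2 * (1 - cos t)) ^ 3)) 0 (PI / 2)).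
    2: { apply (RInt_scal (V := R_CompleteNormedModule) (fun t => sin t * (1 - cos t)
          / ((r - rho) ^ 2 + 2 * r ^ 2 * (1 - cos t)) ^ 3)).
      apply (ex_RInt_continuous (V := R_CompleteNormedModule)); intros t _; apply Cquarter. }
    apply RInt_le; [lra | | apply Ig |].
    { apply (ex_RInt_continuous (V := R_CompleteNormedModule)); intros t _; apply Clow. }
    intros t Ht; assert (Hs := sin_gt_0 t (proj1 Ht) ltac:(lra)).
    apply Rle_trans with (2 := Hg0 t (Rlt_le _ _ Hs)).
    assert (Hc : 0 < cos t) by (apply cos_gt_0; lra).
    assert (H := axis_W2_pos t); assert (Hc1 := COS_bound t).
    assert (HWle : W2 t <= (r - rho) ^ 2 + 2 * r ^ 2 * (1 - cos t)).
    { replace (W2 t) with ((r - rho) ^ 2 + 2 * (r * rho) * (1 - cos t)) by (unfold W2; ring).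
      apply Rplus_le_compat_l, Rmult_le_compat_r; nra. }
    set (B := (r - rho) ^ 2 + 2 * r ^ 2 * (1 - cos t)) in *.
    replace (PI * r ^ 2 * sin t * ((r * sin t) ^ 2 * inner3 p p))
      with (PI * r ^ 4 * inner3 p p * (sin t * sin t ^ 2)) by ring.
    unfold Rdiv; rewrite (Rmult_assoc _ (sin t * sin t ^ 2)).
    assert (Hr4 : 0 < r ^ 4) by (apply pow_lt; lra).
    apply Rmult_le_compat_l; [apply Rmult_le_pos; [apply Rmult_le_pos |]; lra |].
    apply Rmult_le_compat.
    - apply Rmult_le_pos; lra.
    - apply Rlt_le, Rinv_0_lt_compat, pow_lt; lra.
    - apply Rmult_le_compat_l; [lra |].
      assert (S := cos2_sin2 t); nra.
    - apply Rinv_le_contravar; [apply pow_lt, H | apply pow_incr; lra]. }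
  assert (Hsnd : 0 <= RInt g (PI / 2) PI).
  { apply RInt_ge_0; [lra | apply Ig |]; intros t Ht.
    assert (Hs := sin_gt_0 t ltac:(lra) (proj2 Ht)).
    apply Rle_trans with (2 := Hg0 t (Rlt_le _ _ Hs)).
    assert (H := axis_W2_pos t).
    apply Rmult_le_pos; [| apply Rlt_le, Rinv_0_lt_compat, pow_lt, H].
    apply Rmult_le_pos; [apply Rmult_le_pos; [apply Rmult_le_pos |]; lra |].
    apply Rmult_le_pos; [apply pow2_ge_0 | exact Hpp]. }
  rewrite <- (RInt_Chasles g 0 (PI / 2) PI) by apply Ig.
  change (r ^ 2 * PI / 18 / (r ^ 2 - rho ^ 2) ^ 2 * inner3 p p
    <= RInt g 0 (PI / 2) + RInt g (PI / 2) PI).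
  apply Rle_trans with (2 := Rplus_le_compat _ _ _ _ Hfst Hsnd); rewrite RInt_near_pole, Rplus_0_r.
  replace (r ^ 2 * PI / 18 / (r ^ 2 - rho ^ 2) ^ 2 * inner3 p p)
    with (PI * inner3 p p * (r ^ 2 / 18 / (r ^ 2 - rho ^ 2) ^ 2)) by (field; lra).
  rewrite (Rmult_assoc PI (r ^ 4)), (Rmult_comm (r ^ 4)), <- (Rmult_assoc PI (inner3 p p)),
    (Rmult_assoc (PI * _)).
  apply Rmult_le_compat_l; [apply Rmult_le_pos; lra |].
  set (m := r - rho) in *.
  assert (Hm0 : 0 < m <= r) by (unfold m; lra).
  replace (r ^ 2 - rho ^ 2) with (m * (r + rho)) by (unfold m; ring).
  assert (Hle : m ^ 2 <= r ^ 2) by (apply pow_incr; lra).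
  (* Since [m <= r], [m^2 + 2 r^2 <= 3 r^2], and [2 * 3^2] gives the 18. The other comparison uses
     [r <= r + rho]. *)
  apply Rle_trans with (/ (18 * m ^ 2)).
  + replace (r ^ 2 / 18 / (m * (r + rho)) ^ 2)
      with (/ (18 * m ^ 2) * (r ^ 2 / (r + rho) ^ 2)) by (field; lra).
    rewrite <- (Rmult_1_r (/ (18 * m ^ 2))) at 2.
    apply Rmult_le_compat_l; [apply Rlt_le, Rinv_0_lt_compat; lra |].
    apply Rmult_le_reg_r with ((r + rho) ^ 2); [apply pow_lt; lra |].
    unfold Rdiv; rewrite Rmult_assoc, Rinv_l by (apply pow_nonzero; lra).
    rewrite Rmult_1_r, Rmult_1_l; apply pow_incr; lra.
  + replace (/ (18 * m ^ 2)) with (r ^ 4 * / (2 * m ^ 2 * (3 * r ^ 2) ^ 2)) by (field; lra).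
    apply Rmult_le_compat_l; [apply pow_le; lra |].
    apply Rinv_le_contravar.
    * apply Rmult_lt_0_compat; [lra | apply pow_lt; lra].
    * apply Rmult_le_compat_l; [lra | apply pow_incr; lra].
- apply Rle_trans with (RInt (fun t => 2 * PI * r ^ 2 * inner3 p p * (sin t / W2 t ^ 2)) 0 PI).
  + apply RInt_le; [lra | apply Ig | apply (ex_RInt_continuous (V := R_CompleteNormedModule)); auto |].
    intros t Ht; assert (H := axis_W2_pos t); assert (Hs := sin_gt_0 t (proj1 Ht) (proj2 Ht)).
    rewrite Hg.
    replace (2 * PI * r ^ 2 * inner3 p p * (sin t / W2 t ^ 2))
      with (PI * r ^ 2 * sin t * (2 * W2 t * inner3 p p) / W2 t ^ 3) by (field; lra).
    apply Rmult_le_compat_r; [apply Rlt_le, Rinv_0_lt_compat, pow_lt, H |].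
    apply Rmult_le_compat_l; [apply Rmult_le_pos; [apply Rmult_le_pos |]; lra |].
    assert (Hw := HW2 t).
    assert (A := pow2_ge_0 (r * sin t)); assert (B := pow2_ge_0 (r * cos t - rho)).
    assert (P1 := pow2_ge_0 (pr1 p)); assert (P2 := pow2_ge_0 (pr2 p)); assert (P3 := pow2_ge_0 (pr3 p)).
    replace (inner3 p p) with (pr1 p ^ 2 + pr2 p ^ 2 + pr3 p ^ 2) by (unfold inner3; ring).
    nra.
  + right.
    replace (RInt (fun t => 2 * PI * r ^ 2 * inner3 p p * (sin t / W2 t ^ 2)) 0 PI)
      with (2 * PI * r ^ 2 * inner3 p p * RInt (fun t => sin t / W2 t ^ 2) 0 PI).
    * rewrite RInt_inv_dist4; field; lra.
    * symmetry; apply (RInt_scal (V := R_CompleteNormedModule) (fun t => sin t / W2 t ^ 2)).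
      apply (ex_RInt_continuous (V := R_CompleteNormedModule)); intros t _; apply Cinv4.
Qed.

End Axis.

(** * Transfer of the integrals from the polar axis to arbitrary z *)

Lemma inner3_rot2_l (s : R) (u v : R3) :
  inner3 (rot2 s u) v = inner3 u (rot2 (- s) v).
Proof. now rewrite <- (inner3_rot2 s u), rot2_inv. Qed.

Lemma inner3_rot3_l (s : R) (u v : R3) :
  inner3 (rot3 s u) v = inner3 u (rot3 (- s) v).
Proof. now rewrite <- (inner3_rot3 s u), rot3_inv. Qed.

Lemma inner3_comm (u v : R3) : inner3 u v = inner3 v u.
Proof. unfold inner3; ring. Qed.

Lemma surf_int_ext (r : R) (f g : R3 -> R) :
  (forall x, on_sphere r x -> f x = g x) -> surf_int r f = surf_int r g.
Proof.
intros H; apply RInt_ext; intros t _; apply RInt_ext; intros u _.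
now rewrite H by apply on_sphere_pt.
Qed.

(** Only scalar products occur, so rotating [x] and [z] together amounts to rotating [p] and [q]
    backwards. *)
Lemma num_density_rot2 (s : R) (z p q x : R3) :
  num_density (rot2 s z) p q (rot2 s x) = num_density z (rot2 (- s) p) (rot2 (- s) q) x.
Proof.
unfold num_density.
rewrite rot2_sub3, !norm3_inner3, !inner3_rot2, (inner3_rot2_l s x).
now rewrite (inner3_comm p (rot2 _ _)), inner3_rot2_l, (inner3_comm (sub3 x z)).
Qed.

Lemma num_density_rot3 (s : R) (z p q x : R3) :
  num_density (rot3 s z) p q (rot3 s x) = num_density z (rot3 (- s) p) (rot3 (- s) q) x.
Proof.
unfold num_density.
rewrite rot3_sub3, !norm3_inner3, !inner3_rot3, (inner3_rot3_l s x).
now rewrite (inner3_comm p (rot3 _ _)), inner3_rot3_l, (inner3_comm (sub3 x z)).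
Qed.

Lemma den_density_rot2 (s : R) (z p x : R3) :
  den_density (rot2 s z) p (rot2 s x) = den_density z (rot2 (- s) p) x.
Proof.
unfold den_density.
now rewrite rot2_sub3, !norm3_inner3, !inner3_rot2, (inner3_rot2_l s).
Qed.

Lemma den_density_rot3 (s : R) (z p x : R3) :
  den_density (rot3 s z) p (rot3 s x) = den_density z (rot3 (- s) p) x.
Proof.
unfold den_density.
now rewrite rot3_sub3, !norm3_inner3, !inner3_rot3, (inner3_rot3_l s).
Qed.

Lemma in_ball_rot2 (r s : R) (z : R3) : in_ball r z -> in_ball r (rot2 s z).
Proof. unfold in_ball; now rewrite !norm3_inner3, inner3_rot2. Qed.

Lemma in_ball_rot3 (r s : R) (z : R3) : in_ball r z -> in_ball r (rot3 s z).
Proof. unfold in_ball; now rewrite !norm3_inner3, inner3_rot3. Qed.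

(** [p] and [q] are quantified after [z] because each rotation step applies the induction hypothesis
    to rotated vectors. *)
Lemma num_integral (r : R) (z : R3) : in_ball r z -> forall p q,
  surf_int r (num_density z p q) = 8 * PI * r / 3 * inner3 p q.
Proof.
revert z; apply (rotation_ind r (fun z => forall p q,
  surf_int r (num_density z p q) = 8 * PI * r / 3 * inner3 p q)).
- intros rho Hrho p q; now apply num_integral_axis.
- intros s z Hz IH p q.
  rewrite <- (surf_int_rot2 r s) by now apply sphere_C1_num_density, in_ball_rot2.
  rewrite (surf_int_ext r _ _ (fun x _ => num_density_rot2 s z p q x)), IH.
  now rewrite inner3_rot2.
- intros s z Hz IH p q.
  rewrite <- (surf_int_rot3 r s) by now apply sphere_C1_num_density, in_ball_rot3.
  rewrite (surf_int_ext r _ _ (fun x _ => num_density_rot3 s z p q x)), IH.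
  now rewrite inner3_rot3.
Qed.

Lemma den_integral (r : R) (z : R3) : in_ball r z -> forall p,
  r ^ 2 * PI / 18 / (r ^ 2 - norm3 z ^ 2) ^ 2 * inner3 p p
    <= surf_int r (den_density z p)
    <= 4 * PI * r ^ 2 / (r ^ 2 - norm3 z ^ 2) ^ 2 * inner3 p p.
Proof.
revert z; apply (rotation_ind r (fun z => forall p,
  r ^ 2 * PI / 18 / (r ^ 2 - norm3 z ^ 2) ^ 2 * inner3 p p
    <= surf_int r (den_density z p)
    <= 4 * PI * r ^ 2 / (r ^ 2 - norm3 z ^ 2) ^ 2 * inner3 p p)).
- intros rho Hrho p.
  replace (norm3 (0, 0, rho) ^ 2) with (rho ^ 2)
    by (rewrite norm3_sq; unfold inner3, pr1, pr2, pr3; simpl; ring).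
  now apply den_integral_axis.
- intros s z Hz IH p.
  rewrite <- (surf_int_rot2 r s) by now apply sphere_C1_den_density, in_ball_rot2.
  rewrite (surf_int_ext r _ _ (fun x _ => den_density_rot2 s z p x)).
  rewrite norm3_sq, inner3_rot2, <- norm3_sq, <- (inner3_rot2 (- s) p p); apply IH.
- intros s z Hz IH p.
  rewrite <- (surf_int_rot3 r s) by now apply sphere_C1_den_density, in_ball_rot3.
  rewrite (surf_int_ext r _ _ (fun x _ => den_density_rot3 s z p x)).
  rewrite norm3_sq, inner3_rot3, <- norm3_sq, <- (inner3_rot3 (- s) p p); apply IH.
Qed.

Lemma RInt_linear (f g : R -> R) (a b k l : R) : ex_RInt f a b -> ex_RInt g a b ->
  RInt (fun x => k * f x + l * g x) a b = k * RInt f a b + l * RInt g a b.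
Proof.
intros Hf Hg; apply (is_RInt_unique (V := R_CompleteNormedModule)).
apply (is_RInt_plus (V := R_NormedModule) (fun x => k * f x) (fun x => l * g x)).
- apply (is_RInt_scal (V := R_NormedModule) f), (RInt_correct (V := R_CompleteNormedModule)), Hf.
- apply (is_RInt_scal (V := R_NormedModule) g), (RInt_correct (V := R_CompleteNormedModule)), Hg.
Qed.

(** [sphere_C1] supplies the continuity that makes the inner and outer Riemann integrals exist. *)
Lemma surf_int_linear (r a b : R) (f g : R3 -> R) : sphere_C1 r f -> sphere_C1 r g ->
  surf_int r (fun x => a * f x + b * g x) = a * surf_int r f + b * surf_int r g.
Proof.
intros Hf Hg.
set (I := fun (h : R3 -> R) t u => h (sphere_pt r t u) * (r ^ 2 * sin t)).
assert (C : forall h : R3 -> R, sphere_C1 r h ->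
  forall p : R * R, continuous (fun q : R * R => I h (fst q) (snd q)) p).
{ intros h (D & Hh) p.
  assert (CX : continuous (fun q : R * R => sphere_pt r (fst q) (snd q) : R * R * R) p)
    by (unfold sphere_pt; cont).
  assert (Ch := continuous_comp _ h p CX (proj1 (Hh _ (on_sphere_pt _ _ _)))).
  unfold I; apply continuous_Rmult; [exact Ch | cont]. }
assert (E1 : forall h t, sphere_C1 r h -> ex_RInt (I h t) 0 (2 * PI))
  by (intros h t Hh; now apply (ex_RInt_section (I h)), C).
assert (HPI := PI_RGT_0).
assert (E2 : forall h, sphere_C1 r h -> ex_RInt (fun t => RInt (I h t) 0 (2 * PI)) 0 PI).
{ intros h Hh; apply (ex_RInt_continuous (V := R_CompleteNormedModule)); intros t _.
  apply (continuous_RInt_param (I h)); [lra | now apply C]. }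
change (RInt (fun t => RInt (fun u => (a * f (sphere_pt r t u) + b * g (sphere_pt r t u))
    * (r ^ 2 * sin t)) 0 (2 * PI)) 0 PI
  = a * RInt (fun t => RInt (I f t) 0 (2 * PI)) 0 PI
    + b * RInt (fun t => RInt (I g t) 0 (2 * PI)) 0 PI).
rewrite <- RInt_linear by now apply E2.
apply RInt_ext; intros t _.
rewrite <- RInt_linear by now apply E1.
apply RInt_ext; intros u _; unfold I; R_eq; ring.
Qed.

(** * Complex polarizations *)

Definition re3 (u : C3) : R3 := map3 Re u.
Definition im3 (u : C3) : R3 := map3 Im u.

Lemma dot_conj3 (u v : C3) : dot u (conj3 v)
  = (inner3 (re3 u) (re3 v) + inner3 (im3 u) (im3 v),
     inner3 (im3 u) (re3 v) - inner3 (re3 u) (im3 v)).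
Proof.
destruct u as [[[? ?] [? ?]] [? ?]], v as [[[? ?] [? ?]] [? ?]].
unfold dot, conj3, re3, im3, inner3, map3, Cconj, Cplus, Cmult, Re, Im, pr1, pr2, pr3.
simpl; f_equal; ring.
Qed.

(** The gradient is real, so the cross product with it acts separately on real and imaginary
    parts. *)
Lemma re3_cross (x : R3) (u : C3) :
  re3 (cross (toC3 x) u) = 
   (pr2 x * pr3 (re3 u) - pr3 x * pr2 (re3 u), pr3 x * pr1 (re3 u) - pr1 x * pr3 (re3 u),
    pr1 x * pr2 (re3 u) - pr2 x * pr1 (re3 u)).
Proof.
destruct x as [[? ?] ?], u as [[[? ?] [? ?]] [? ?]].
unfold re3, cross, toC3, map3, Cminus, Copp, Cplus, Cmult, RtoC, Re, pr1, pr2, pr3.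
simpl; f_equal; [f_equal |]; ring.
Qed.

Lemma im3_cross (x : R3) (u : C3) :
  im3 (cross (toC3 x) u) = 
   (pr2 x * pr3 (im3 u) - pr3 x * pr2 (im3 u), pr3 x * pr1 (im3 u) - pr1 x * pr3 (im3 u),
    pr1 x * pr2 (im3 u) - pr2 x * pr1 (im3 u)).
Proof.
destruct x as [[? ?] ?], u as [[[? ?] [? ?]] [? ?]].
unfold im3, cross, toC3, map3, Cminus, Copp, Cplus, Cmult, RtoC, Im, pr1, pr2, pr3.
simpl; f_equal; [f_equal |]; ring.
Qed.

Lemma normC3_sq (u : C3) :
  normC3 u ^ 2 = inner3 (re3 u) (re3 u) + inner3 (im3 u) (im3 u).
Proof.
unfold normC3; rewrite pow2_sqrt by auto 10 using Rplus_le_le_0_compat, pow2_ge_0.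
unfold Cmod; rewrite !pow2_sqrt by auto using Rplus_le_le_0_compat, pow2_ge_0.
unfold inner3, re3, im3, map3, Re, Im, pr1, pr2, pr3; simpl; ring.
Qed.

(** * Dipole fields on the sphere and the final estimate *)

Lemma dipole_field_eq (y x : R3) (u : C3) : x <> y -> dipole_field y u x
  = cross (toC3 (scal3 (- / (4 * PI * norm3 (sub3 x y) ^ 3)) (sub3 x y))) u.
Proof. intros H; unfold dipole_field; now rewrite grad_G. Qed.

Lemma sphere_neq_ball (r : R) (x z : R3) : on_sphere r x -> in_ball r z -> x <> z.
Proof.
intros Hx Hz ->; assert (H := sphere_dist_pos r z z Hx Hz).
unfold inner3, sub3, pr1, pr2, pr3 in H; simpl in H; lra.
Qed.

Lemma norm3_on_sphere (r : R) (x : R3) : 0 <= r -> on_sphere r x -> norm3 x = r.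
Proof. intros Hr Hx; unfold norm3; rewrite Hx; now apply sqrt_pow2. Qed.

Lemma sphere_dist_norm_pos (r : R) (x z : R3) :
  on_sphere r x -> in_ball r z -> 0 < norm3 (sub3 x z).
Proof.
intros Hx Hz; rewrite norm3_inner3; now apply sqrt_lt_R0, (sphere_dist_pos r).
Qed.

(** For the source at the origin [|x| = r] is constant, so its factor [1 / (4 pi r^3)] leaves the
    integrand; the second field contributes another [1 / (4 pi)], and the two minus signs cancel. *)
Lemma dot_dipole_field (r : R) (z x : R3) (u v : C3) : 0 < r -> in_ball r z ->
  on_sphere r x ->
  dot (dipole_field zero3 u x) (conj3 (dipole_field z v x))
  = (/ (16 * PI ^ 2 * r ^ 3) * num_density z (re3 u) (re3 v) x
       + / (16 * PI ^ 2 * r ^ 3) * num_density z (im3 u) (im3 v) x,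
     / (16 * PI ^ 2 * r ^ 3) * num_density z (im3 u) (re3 v) x
       + - / (16 * PI ^ 2 * r ^ 3) * num_density z (re3 u) (im3 v) x).
Proof.
intros Hr Hz Hx.
assert (H0 : in_ball r zero3).
{ unfold in_ball, norm3, zero3, pr1, pr2, pr3; simpl fst; simpl snd.
  replace (0 ^ 2 + 0 ^ 2 + 0 ^ 2) with 0 by ring; now rewrite sqrt_0. }
rewrite !dipole_field_eq by now apply (sphere_neq_ball r).
assert (E : sub3 x zero3 = x).
{ destruct x as [[? ?] ?]; unfold sub3, zero3, pr1, pr2, pr3; simpl.
  now rewrite !Rminus_0_r. }
rewrite E, (norm3_on_sphere r x) by (assumption || lra).
assert (Hd := sphere_dist_norm_pos r x z Hx Hz).
rewrite dot_conj3, !re3_cross, !im3_cross; unfold num_density.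
set (w := sub3 x z) in *; set (d := norm3 w) in *.
assert (HPI := PI_RGT_0).
unfold inner3, scal3; unfold pr1, pr2, pr3; simpl fst; simpl snd.
f_equal; field; lra.
Qed.

Lemma normC3_dipole_field (r : R) (z x : R3) (v : C3) : in_ball r z -> on_sphere r x ->
  normC3 (dipole_field z v x) ^ 2
  = / (16 * PI ^ 2) * den_density z (re3 v) x + / (16 * PI ^ 2) * den_density z (im3 v) x.
Proof.
intros Hz Hx.
rewrite dipole_field_eq by now apply (sphere_neq_ball r).
rewrite normC3_sq, re3_cross, im3_cross; unfold den_density.
assert (Hd := sphere_dist_norm_pos r x z Hx Hz).
set (w := sub3 x z) in *; set (d := norm3 w) in *.
assert (HPI := PI_RGT_0).
unfold inner3, scal3; unfold pr1, pr2, pr3; simpl fst; simpl snd.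
field; lra.
Qed.

(** The four real integrals share the constant [8 pi r / 3], so they recombine into the complex
    product, and [(8 pi r / 3) / (16 pi^2 r^3) = 1 / (6 pi r^2)]. *)
Lemma inner_gamma_dipole_field (r : R) (z : R3) (u v : C3) : 0 < r -> in_ball r z ->
  inner_gamma r 0 (dipole_field zero3 u) (dipole_field z v)
  = (RtoC (/ (6 * PI * r ^ 2)) * dot u (conj3 v))%C.
Proof.
intros Hr Hz; unfold inner_gamma, surf_intC, neg_lb_pow; simpl Nat.iter.
assert (HPI := PI_RGT_0).
rewrite (surf_int_ext r _ _
  (fun x Hx => f_equal Re (dot_dipole_field r z x u v Hr Hz Hx))).
rewrite (surf_int_ext r (fun x => Im _) _
  (fun x Hx => f_equal Im (dot_dipole_field r z x u v Hr Hz Hx))).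
simpl Re; simpl Im.
rewrite !surf_int_linear, !num_integral by (try apply sphere_C1_num_density; assumption).
rewrite dot_conj3; unfold Cmult, RtoC; simpl; f_equal; field; lra.
Qed.

(** The bounds for the real and imaginary parts add up with [|v|^2 = 1]. Divided by [16 pi^2], the
    upper constant [4 pi] gives [D0] exactly and the lower one [pi / 18] gives [D0 / 72]. *)
Lemma norm_gamma_dipole_field (r : R) (z : R3) (v : C3) :
  0 < r -> in_ball r z -> in_S v ->
  sqrt (D0 r z / 72) <= norm_gamma r 0 (dipole_field z v) <= sqrt (D0 r z).
Proof.
intros Hr Hz Hv; unfold norm_gamma, neg_lb_pow; simpl Nat.div2; simpl Nat.iter.
assert (HPI := PI_RGT_0).
rewrite (surf_int_ext r _ _ (fun x Hx => normC3_dipole_field r z x v Hz Hx)).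
rewrite surf_int_linear by now apply sphere_C1_den_density.
assert (H1 := den_integral r z Hz (re3 v)).
assert (H2 := den_integral r z Hz (im3 v)).
assert (E := normC3_sq v); rewrite Hv in E.
assert (HD : 0 < r ^ 2 - norm3 z ^ 2).
{ assert (0 <= norm3 z) by apply sqrt_pos; unfold in_ball in Hz; nra. }
set (D := r ^ 2 - norm3 z ^ 2) in *.
assert (HP2 : 0 < / (16 * PI ^ 2)) by (apply Rinv_0_lt_compat; nra).
split; apply sqrt_le_1_alt; rewrite <- Rmult_plus_distr_l; unfold D0; fold D.
- replace (r ^ 2 / (4 * PI * D ^ 2) / 72)
    with (/ (16 * PI ^ 2) * (r ^ 2 * PI / 18 / D ^ 2 * 1 ^ 2)) by (field; lra).
  apply Rmult_le_compat_l; [lra |]; rewrite E; lra.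
- replace (r ^ 2 / (4 * PI * D ^ 2))
    with (/ (16 * PI ^ 2) * (4 * PI * r ^ 2 / D ^ 2 * 1 ^ 2)) by (field; lra).
  apply Rmult_le_compat_l; [lra |]; rewrite E; lra.
Qed.

Theorem proposition3p3 (r : R) (hr : 0 < r) :
  exists c C0 : R, 0 < c /\ 0 < C0 /\
    forall (z : R3) (alpha beta : C3),
      in_ball r z -> in_S alpha -> in_S beta ->
      c * (Cmod (dot alpha (conj3 beta)) / sqrt (D0 r z))
        <= Cmod (psf r 0 zero3 alpha z beta)
      /\ Cmod (psf r 0 zero3 alpha z beta)
        <= C0 * (Cmod (dot alpha (conj3 beta)) / sqrt (D0 r z)).
Proof.
assert (HPI := PI_RGT_0).
assert (Hr2 : 0 < r ^ 2) by (apply pow_lt; lra).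
assert (Hk : 0 < / (6 * PI * r ^ 2))
  by (apply Rinv_0_lt_compat, Rmult_lt_0_compat; lra).
assert (H72 : 0 < sqrt 72) by (apply sqrt_lt_R0; lra).
(* The numerator is known exactly; [c] comes from the upper bound [sqrt D0] on the norm, and the
   extra [sqrt 72] from its lower bound. *)
exists (/ (6 * PI * r ^ 2)), (/ (6 * PI * r ^ 2) * sqrt 72).
split; [exact Hk | split; [now apply Rmult_lt_0_compat |]].
intros z u v Hz _ Hv.
assert (HD : 0 < D0 r z).
{ assert (0 < r ^ 2 - norm3 z ^ 2)
    by (assert (0 <= norm3 z) by apply sqrt_pos; unfold in_ball in Hz; nra).
  unfold D0; apply Rdiv_lt_0_compat; [exact Hr2 |].
  apply Rmult_lt_0_compat; [lra | now apply pow_lt]. }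
assert (HsD := sqrt_lt_R0 _ HD).
destruct (norm_gamma_dipole_field r z v hr Hz Hv) as [Hlo Hup].
rewrite sqrt_div in Hlo by lra.
assert (Hq : 0 < sqrt (D0 r z) / sqrt 72) by now apply Rdiv_lt_0_compat.
unfold psf; rewrite inner_gamma_dipole_field by assumption.
set (N := norm_gamma _ _ _) in *.
assert (HN : 0 < N) by lra.
rewrite Cmod_div by (intros E; apply (f_equal Re) in E; simpl in E; lra).
rewrite Cmod_mult, !Cmod_R, !Rabs_pos_eq by lra.
set (A := Cmod _); assert (HA : 0 <= A) by apply Cmod_ge_0.
split.
- unfold Rdiv; rewrite <- Rmult_assoc.
  apply Rmult_le_compat_l; [apply Rmult_le_pos; lra |].
  now apply Rinv_le_contravar.
- replace (/ (6 * PI * r ^ 2) * sqrt 72 * (A / sqrt (D0 r z)))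
    with (/ (6 * PI * r ^ 2) * A * / (sqrt (D0 r z) / sqrt 72)) by (field; lra).
  apply Rmult_le_compat_l; [apply Rmult_le_pos; lra |].
  now apply Rinv_le_contravar.
Qed.
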